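(* Suppose there exist a parameter value $\bar\theta\in\operatorname{int}\Theta$, a neighbourhood $M$ of $\bar\theta$, and a (possibly random) $\mathbb{R}^p$-valued function $G$ on $M$ such that: (i) $G_n(\bar\theta)\to 0$ in $\mathbb{P}$-probability as $n\to\infty$, and $G(\bar\theta)=0$; (ii) for $\mathbb{P}$-almost all $\omega$, $G(\cdot,\omega)$ and all $G_n(\cdot,\omega)$ are continuously differentiable on $M$, and $\sup_{\theta\in M}\|\partial_\theta G_n(\theta)-\partial_\theta G(\theta)\|\to 0$ in $\mathbb{P}$-probability; (iii) the matrix $\partial_\theta G(\bar\theta)$ is non-singular with $\mathbb{P}$-probability one. Suppose also that there is a sequence of positive real numbers $a_n$ increasing to infinity such that the sequence $a_nG_n(\bar\theta)$ is stochastically bounded, i.e. for every $\varepsilon>0$ there exists $K>0$ such that $\mathbb{P}(|a_nG_n(\bar\theta)|>K)<\varepsilon$ for all $n$. Then there is a sequence $(\hat\theta_n)$ of $G_n$-estimators such that $$\lim_{c\to\infty}\ \inf_n\ \mathbb{P}\big(|a_n(\hat\theta_n-\bar\theta)|\le c\big)=1,$$ in other words, the sequence $(a_n|\hat\theta_n-\bar\theta|)$ is stochastically bounded. Moreover, any sequence $(\hat\theta_n)$ of $G_n$-estimators which is weakly $\bar\theta$-consistent has this property.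
   Context: Setting: $(\Omega,\mathcal{F},\mathbb{P})$ is a complete probability space ($\mathbb{P}$ is the true measure), $\Theta\subseteq\mathbb{R}^p$ is the parameter set, and for each $n$, $\mathcal{F}_n\subseteq\mathcal{F}$ is a $\mathbb{P}$-complete sub-$\sigma$-field (generated by the observations at stage $n$). An estimating function at stage $n$ is a map $G_n:\Theta\times\Omega\to\mathbb{R}^p$ that is measurable with respect to the product of the Borel $\sigma$-field of $\Theta$ with $\mathcal{F}_n$; the argument $\omega$ is usually suppressed. $G_n$-estimators: let $\delta$ be an extra point outside $\Theta$ and $\Theta_\delta=\Theta\cup\{\delta\}$. Let $D_n$ be the set of all $\omega$ for which $G_n(\theta,\omega)=0$ for at least one $\theta\in\Theta$. A $G_n$-estimator is any $\mathcal{F}_n$-measurable map $\hat\theta_n:\Omega\to\Theta_\delta$ such that $\hat\theta_n\in\Theta$ and $G_n(\hat\theta_n)=0$ on $D_n$, and $\hat\theta_n=\delta$ on the complement of $D_n$. The metric on $\Theta_\delta$ is the Euclidean metric on $\Theta$, and the distance between $\delta$ and any point of $\Theta$ is $1$; accordingly $|\hat\theta_n-\bar\theta|=1$ by convention when $\hat\theta_n=\delta$. A sequence $(\hat\theta_n)$ is weakly $\bar\theta$-consistent if $\hat\theta_n\to\bar\theta$ in $\mathbb{P}$-probability as $n\to\infty$. $|\cdot|$ is the Euclidean norm, $\|\cdot\|$ the operator norm on $p\times p$ matrices, and $\partial_\theta G$ the $p\times p$ Jacobian matrix.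
   Formalization: The parameter set Θ is additionally assumed to be a Borel subset of R^p; for an arbitrary Θ the set D_n can be non-measurable, so that no G_n-estimator exists and the first conclusion fails. *)

(* Defs.v *)
From HB Require Import structures.
From mathcomp Require Import all_boot all_order all_algebra.
From mathcomp Require Import all_classical all_reals all_analysis.

Set Implicit Arguments.
Unset Strict Implicit.
Unset Printing Implicit Defensive.

Import Order.TTheory GRing.Theory Num.Theory.
Import numFieldNormedType.Exports.

Local Open Scope classical_set_scope.
Local Open Scope ring_scope.

(* The library norm on 'rV[R]_p is the sup norm; it induces the same topology
   and differentials as the Euclidean norm, but the quantitative statements
   below are about the Euclidean norm. *)
Definition enorm (R : realType) (p : nat) (v : 'rV[R]_p) : R :=
  Num.sqrt (\sum_(i < p) v ord0 i ^+ 2).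

(* Matrices act on row vectors on the right, as the library's [jacobian] does:
   [jacobian f x] is the transpose of the matrix (d f_i / d x_j)_(i,j).  The
   Euclidean operator norm and invertibility are transposition-invariant. *)
Definition opnorm (R : realType) (p : nat) (A : 'M[R]_p) : R :=
  sup [set enorm (v *m A) | v in [set v : 'rV[R]_p | enorm v <= 1]].

(* R^p with its Borel sigma-algebra. *)
Notation borel_rV R p := (g_sigma_algebraType (@open 'rV[R]_p)).

(* M is meant to be open, so that differentiability at the points of M and
   continuity of the jacobian there only depend on the restriction of f to M. *)
Definition continuously_differentiable_on (R : realType) (p : nat)
    (M : set 'rV[R]_p) (f : 'rV[R]_p -> 'rV[R]_p) : Prop :=
  forall x, M x ->
    differentiable f x /\ {for x, continuous (fun y => jacobian f y)}.

Section Probability.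
Context d (Omega : measurableType d) (R : realType) (P : probability Omega R).

(* F is a sub-sigma-field on which the restriction of P is complete. *)
Definition complete_sub_sigma_field (F : set (set Omega)) : Prop :=
  [/\ sigma_algebra setT F,
      F `<=` measurable &
      forall A B : set Omega, F A -> P A = 0%E -> B `<=` A -> F B].

(* For nonnegative X_n; the values may be infinite, since a supremum over a
   neighbourhood need not be finite. *)
Definition cvg_to_zero_in_probability (X : nat -> Omega -> \bar R) : Prop :=
  forall e : R, 0 < e ->
    P [set w | (e%:E < X n w)%E] @[n --> \oo] --> 0%E.

Definition stochastically_bounded (X : nat -> Omega -> R) : Prop :=
  forall e : R, 0 < e -> exists K : R, 0 < K /\
    forall n, (P [set w | (K < X n w)%R] < e%:E)%E.

Section EstimatingFunctions.
Variable p : nat.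
Variables (Theta : set 'rV[R]_p) (F : set (set Omega)).
Implicit Types (G : 'rV[R]_p -> Omega -> 'rV[R]_p).

(* Only the values of G on Theta `*` setT matter: measurability there is with
   respect to the trace of the product of the Borel sigma-algebra and F (F is a
   sigma-algebra, so it is the sigma-algebra of [g_sigma_algebraType F]). *)
Definition estimating_function G : Prop :=
  @measurable_fun _ _ (borel_rV R p * g_sigma_algebraType F)%type (borel_rV R p)
    (Theta `*` setT) (fun z => G z.1 z.2).

(* [None] is the extra point delta, and it is isolated because its distance to
   every parameter is 1.  The estimators below take values in Theta or delta,
   so it does not matter that all of R^p is included. *)
Definition open_delta : set (set (option 'rV[R]_p)) :=
  [set V | open (Some @^-1` V)].

Definition dist_delta (x : option 'rV[R]_p) (theta : 'rV[R]_p) : R :=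
  if x is Some t then enorm (t - theta) else 1.

Definition solvable_event G : set Omega :=
  [set w | exists2 theta, Theta theta & G theta w = 0].

Definition is_estimator G (that : Omega -> option 'rV[R]_p) : Prop :=
  [/\ @measurable_fun _ _ (g_sigma_algebraType F)
        (g_sigma_algebraType open_delta) setT that,
      (forall w, solvable_event G w ->
         exists theta, [/\ that w = Some theta, Theta theta & G theta w = 0]) &
      (forall w, ~ solvable_event G w -> that w = None)].

End EstimatingFunctions.

Definition weakly_consistent (p : nat)
    (that : nat -> Omega -> option 'rV[R]_p) (theta : 'rV[R]_p) : Prop :=
  cvg_to_zero_in_probability (fun n w => (dist_delta (that n w) theta)%:E).

(* |a_n (that_n - theta)| is a_n times the distance in Theta with delta added,
   hence a_n when that_n = delta. *)
Definition has_rate (p : nat) (a : nat -> R)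
    (that : nat -> Omega -> option 'rV[R]_p) (theta : 'rV[R]_p) : Prop :=
  ereal_inf (range (fun n =>
      P [set w | a n * dist_delta (that n w) theta <= c]))
    @[c --> +oo%R] --> 1%E.

End Probability.

(* Main.v *)
(** Analytic part.  With [G' thetabar] invertible, [G] satisfies
    [|x - y| <= K |G x - G y|] on a ball around [thetabar]; [K] and the radius are
    random, but by continuity from above they can be taken deterministic off an
    event of small probability.  When [G_n' - G'] is uniformly small, [G_n]
    satisfies the same inequality with [2 K].  Then every zero [t] of [G_n] in the
    ball has [|t - thetabar| <= 2 K |G_n thetabar|], which is [O(1/a_n)]; and a zero
    exists, because a minimizer of [|G_n|] on a closed ball is interior as soon as
    [G_n thetabar] is small, and [G_n'] is invertible there.

    Measurable part.  An estimator has to select a zero of [G_n] measurably on the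
    whole projection of [{G_n = 0}], where [G_n] is merely product measurable.
    This is the measurable selection theorem for a complete probability space,
    obtained from Suslin's operation: measurable sets of pairs are Suslin sets, and
    measurable hulls of the sets attached to finite prefixes give a selection
    outside a null set.  Selecting inside balls of radius [j/a_n] for the least
    possible [j] makes the estimator as close to [thetabar] as any zero, up to
    [1/a_n]. *)

Require Import Defs.
From HB Require Import structures.
From mathcomp Require Import all_boot all_order all_algebra.
From mathcomp Require Import all_classical all_reals all_analysis.
From mathcomp Require Import measurable_realfun ring lra.

Set Implicit Arguments.
Unset Strict Implicit.
Unset Printing Implicit Defensive.

Import Order.TTheory GRing.Theory Num.Theory.
Import numFieldNormedType.Exports.

Local Open Scope classical_set_scope.
Local Open Scope ring_scope.

(** * Measurable hulls and Suslin's operation *)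

Section MeasurableHull.
Context d (T : measurableType d) (R : realType).
Variable mu : {measure set T -> \bar R}.
Hypothesis mu_fin : (mu setT < +oo)%E.

(** Intersect measurable supersets whose measures approach the infimum over all measurable
    supersets. If the intersection exceeded some measurable [B] containing [X] by positive measure,
    then cutting a late superset down to [B] would fall below that infimum. *)
Lemma measurable_hull (X : set T) : exists H : set T,
  [/\ measurable H, X `<=` H &
      forall B, measurable B -> X `<=` B -> mu (H `\` B) = 0%E].
Proof.
pose S := [set mu B | B in [set B | measurable B /\ X `<=` B]].
have Sne : S (mu setT) by exists setT.
have fin (A : set T) : measurable A -> mu A \is a fin_num.
  move=> mA; rewrite ge0_fin_numE//.
  by apply: le_lt_trans mu_fin; apply: le_measure => //; rewrite inE.
have Sfin : ereal_inf S \is a fin_num.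
  rewrite ge0_fin_numE; last by apply: le_ereal_inf_tmp => _ [B _ <-].
  exact: le_lt_trans (ereal_inf_lbound Sne) mu_fin.
have /choice[B BP] : forall n : nat, exists B, [/\ measurable B, X `<=` B &
    (mu B < ereal_inf S + (n.+1%:R^-1)%:E)%E].
  move=> n; have n0 : (0 < n.+1%:R^-1 :> R) by rewrite invr_gt0.
  by have [_ [B [mB XB] <-] ltB] := lb_ereal_inf_adherent n0 Sfin; exists B.
have mH : measurable (\bigcap_n B n).
  by apply: bigcapT_measurable => n; case: (BP n).
exists (\bigcap_n B n); split => //.
  by move=> x Xx n _; case: (BP n) => _ + _; apply.
move=> C mC XC.
have mHC := measurableD mH mC.
apply/eqP; rewrite eq_le measure_ge0 andbT; apply/lee_addgt0Pr => e e0.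
have [n ne] : exists n : nat, n.+1%:R^-1 < e.
  have /= [n _ ne] := near_infty_natSinv_lt (PosNum e0).
  by exists n; apply: ne => /=.
rewrite add0e; have [mB XB ltB] := BP n.
have HB : \bigcap_n B n `<=` B n by move=> x; apply.
have : (mu (B n `&` C) + mu (B n `\` C) < ereal_inf S + e%:E)%E.
  rewrite addeC -measureDI //; apply: lt_trans ltB _.
  by rewrite lteD2lE ?lte_fin.
have : (ereal_inf S <= mu (B n `&` C))%E.
  apply: ereal_inf_lbound; exists (B n `&` C) => //; split.
    exact: measurableI.
  by move=> x Xx; split; [exact: XB|exact: XC].
have mBC : measurable (B n `&` C) by exact: measurableI.
have mBD : measurable (B n `\` C) by exact: measurableD.
move=> le1 lt2.
have le3 : (mu (\bigcap_n B n `\` C) <= mu (B n `\` C))%E.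
  by apply: le_measure; rewrite ?inE //; exact: setSD.
apply: le_trans le3 _.
move: le1 lt2.
rewrite -(fineK (fin _ mBC)) -(fineK (fin _ mBD)) -(fineK Sfin).
rewrite -!EFinD lte_fin !lee_fin => le1 lt2.
by rewrite -(lerD2l (fine (ereal_inf S))); apply: le_trans (ltW lt2); rewrite lerD2r.
Qed.

End MeasurableHull.

Section SuslinSelection.
Context d (T : measurableType d).

(** The event that the least index is k is [B k] minus the earlier sets. Off the union the index
    defaults to 0, which only enlarges the event for k = 0 by a measurable set. *)
Lemma measurable_least_index (B : (set T)^nat) : (forall k, measurable (B k)) ->
  exists f : T -> nat, [/\ forall k, measurable [set w | f w = k],
    forall w, (\bigcup_k B k) w -> B (f w) w &
    forall w k, B k w -> (f w <= k)%N].
Proof.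
move=> mB.
have /choice[f fP] : forall w, exists m, ((\bigcup_k B k) w -> B m w) /\
    ((~ (\bigcup_k B k) w -> m = 0%N) /\ forall k, B k w -> (m <= k)%N).
  move=> w; have [[k _ Bk]|nB] := pselect ((\bigcup_k B k) w); last first.
    by exists 0%N; split => // /nB.
  have ex : exists k, `[< B k w >] by exists k; apply/asboolP.
  exists (ex_minn ex); case: ex_minnP => m /asboolP Bm mP; split => //.
  by split=> [[]|j Bj]; [exists k|apply: mP; apply/asboolP].
exists f; split=> [k|w|w]; [|by case: (fP w)|by case: (fP w) => _ []].
have -> : [set w | f w = k] =
    seqDU B k `|` (if k == 0%N then ~` (\bigcup_k B k) else set0).
  apply/seteqP; split=> w.
    move=> <-{k}; have [f1 [f2 f3]] := fP w.
    have [Bw|nBw] := pselect ((\bigcup_k B k) w).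
      left; split; first exact: f1.
      rewrite -bigcup_mkord => -[j /= ltj Bj].
      by have := f3 _ Bj; rewrite leqNgt ltj.
    by right; rewrite f2//.
  have [f1 [f2 f3]] := fP w.
  case=> [[Bk]|].
    rewrite -bigcup_mkord => nB; apply/eqP; rewrite eqn_leq f3//= leqNgt.
    by apply/negP => ltf; apply: nB; exists (f w) => //; apply: f1; exists k.
  by case: eqP => // -> /f2.
apply: measurableU; first exact: seqDU_measurable.
by case: ifP => // _; apply: measurableC; exact: bigcup_measurable.
Qed.

Context (R : realType) (mu : {measure set T -> \bar R}).
Hypothesis mu_fin : (mu setT < +oo)%E.
Hypothesis mu_complete : measure_is_complete mu.

Definition agree (N : nat) (s t : nat -> nat) :=
  forall i, (i < N)%N -> s i = t i.

(** Continuity on the Baire space [nat -> nat], with the discrete topology on [X]. *)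
Definition locally_constant (X : Type) (A : (nat -> nat) -> X) :=
  forall s, exists N, forall t, agree N s t -> A t = A s.

Variable A : nat -> (nat -> nat) -> set T.
Hypothesis A_meas : forall n s, measurable (A n s).
Hypothesis A_lc : forall n, locally_constant (A n).

(* Replace, for every finite prefix s, the set of w having a good branch through
   s by a measurable hull H s.  Up to a null set N, a point of H s lies in some
   H (rcons s k), so following the least such k produces a good branch. *)
Lemma suslin_selection :
  measurable [set w | exists s, forall n, A n s w] /\
  exists s : T -> nat -> nat, (forall i k, measurable [set w | s w i = k]) /\
    forall w, (exists s, forall n, A n s w) -> forall n, A n (s w) w.
Proof.
pose D := [set w | exists s, forall n, A n s w].
pose pre (p : seq nat) s := agree (size p) (nth 0%N p) s.
pose Dp p := [set w | exists2 s, pre p s & forall n, A n s w].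
have /choice[H HP] := fun p => measurable_hull mu_fin (Dp p).
have mH p : measurable (H p) by case: (HP p).
have /choice[L LP] := fun p => measurable_least_index (fun k => mH (rcons p k)).
(* Both exceptional sets are null by minimality of the hull [H p]: [Dp p] is covered by the hulls of
   the one-step extensions of [p], and it lies inside [A n] as soon as the prefix [p] decides
   [A n]. *)
pose N1 p := H p `\` \bigcup_k H (rcons p k).
pose N2 p n := if `[< forall t, pre p t -> A n t = A n (nth 0%N p) >]
  then H p `\` A n (nth 0%N p) else set0.
pose Np p := N1 p `|` \bigcup_n N2 p n.
have nNp p : mu.-negligible (Np p).
  apply: negligibleU.
    have m1 : measurable (N1 p) by apply: measurableD => //; exact: bigcup_measurable.
    apply/negligibleP => //; case: (HP p) => _ _; apply.
      exact: bigcup_measurable.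
    move=> w [s ps Aw]; exists (s (size p)) => //.
    case: (HP (rcons p (s (size p)))) => _ + _; apply; exists s => //.
    move=> i; rewrite size_rcons ltnS nth_rcons.
    by case: ltngtP => // [/ps //|->].
  apply: negligible_bigcup => n; rewrite /N2; case: asboolP => [lc|_]; last first.
    exact: negligible_set0.
  apply/negligibleP; first exact: measurableD.
  case: (HP p) => _ _; apply => // w [s ps Aw].
  by rewrite -(lc s).
have [e eK] : exists e : nat -> seq nat, forall p, e (pickle p) = p.
  by exists (fun m => odflt [::] (unpickle m)) => p; rewrite pickleK.
pose N := \bigcup_k Np (e k).
have nN : mu.-negligible N by apply: negligible_bigcup => k.
have mN : measurable N := mu_complete nN.
have sub_meas (B : set T) : B `<=` N -> measurable B.
  by move=> BN; apply: mu_complete; exact: negligibleS nN.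
have NpN p : Np p `<=` N.
  by move=> w Npw; exists (pickle p) => //; rewrite eK.
pose b w := fix b j := if j is j'.+1 then rcons (b j') (L (b j') w) else [::].
pose s0 w i := L (b w i) w.
have size_b w j : size (b w j) = j by elim: j => //= j IH; rewrite size_rcons IH.
have b_pre w j : pre (b w j) (s0 w).
  elim: j => [//|j IH] i; rewrite /= size_rcons nth_rcons size_b ltnS => leij.
  case: ltngtP leij => [ltij _|//|-> _ //].
  by apply: IH; rewrite size_b.
have Hb w : H [::] w -> ~ N w -> forall j, H (b w j) w.
  move=> H0 nNw; elim=> [//|j IH] /=; case: (LP (b w j)) => _ + _; apply.
  by apply: contrapT => nH; apply: nNw; apply: (NpN (b w j)); left; split.
have Abranch w : H [::] w -> ~ N w -> forall n, A n (s0 w) w.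
  (* At a prefix long enough to decide [A n], a failure of [A n] would put [w] into [N2], hence into
     [N]. *)
  move=> H0 nNw n; have [M MP] := A_lc n (s0 w).
  pose p := b w M; apply: contrapT => nA; apply: (nNw); apply: (NpN p); right.
  have pM : agree M (nth 0%N p) (s0 w) by rewrite -{1}(size_b w M); exact: b_pre.
  have AE : A n (nth 0%N p) = A n (s0 w).
    by apply: MP => i iM; rewrite pM.
  exists n => //; rewrite /N2 asboolT; last first.
    move=> t pt; rewrite AE; apply: MP => i iM; rewrite -pM//.
    by apply: pt; rewrite size_b.
  by split; [exact: (Hb _ H0 nNw M)|rewrite AE].
have mb j p : measurable [set w | b w j = p].
  elim: j p => [|j IH] p /=.
    have [->|p0] := eqVneq p [::].
      by rewrite (_ : mkset _ = setT)//; exact/seteqP.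
    by rewrite (_ : mkset _ = set0) // -subset0 => w /esym/eqP; rewrite (negbTE p0).
  case/lastP: p => [|p k].
    rewrite (_ : mkset _ = set0) // -subset0 => w /= /(congr1 size).
    by rewrite size_rcons.
  rewrite (_ : mkset _ = [set w | b w j = p] `&` [set w | L p w = k]).
    by apply: measurableI => //; case: (LP p).
  apply/seteqP; split=> w /=; first by move/rcons_inj => [-> ->].
  by move=> [-> ->].
have ms0 i k : measurable [set w | s0 w i = k].
  rewrite (_ : mkset _ = \bigcup_m ([set w | b w i = e m] `&`
      [set w | L (e m) w = k])).
    apply: bigcup_measurable => m _; apply: measurableI => //.
    by case: (LP (e m)).
  apply/seteqP; split=> w /=; last by case=> m _ /= [<-].
  by move=> Lk; exists (pickle (b w i)) => //; split; rewrite /mkset eK.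
have DH : D `<=` H [::].
  by move=> w [s Aw]; case: (HP [::]) => _ + _; apply; exists s.
(* Off [N] the set coincides with the hull [H [::]]; inside [N] completeness makes every subset
   measurable. *)
have mD : measurable D.
  rewrite (_ : D = (H [::] `\` N) `|` (D `&` N)).
    by apply: measurableU; [exact: measurableD|exact: sub_meas].
  apply/seteqP; split=> w.
    by move=> Dw; have [Nw|nNw] := pselect (N w); [right|left; split; [exact: DH|]].
  by case=> [[Hw nNw]|[]//]; exists (s0 w); exact: Abranch.
split => //.
(* On the null set [N] the greedy branch may fail, so an arbitrary good branch is chosen there; by
   completeness this does not affect measurability. *)
have /choice[s1 s1P] : forall w, exists s, D w -> forall n, A n s w.
  by move=> w; have [[s sP]|nD] := pselect (D w); [exists s|exists (s0 w)].
exists (fun w => if `[< N w >] then s1 w else s0 w); split=> [i k|w Dw].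
  pose s2 w := if `[< N w >] then s1 w else s0 w.
  rewrite (_ : mkset _ = ([set w | s0 w i = k] `\` N) `|`
      ([set w | s2 w i = k] `&` N)).
    by apply: measurableU; [exact: measurableD|exact: sub_meas].
  rewrite /s2; apply/seteqP; split=> w /=; case: asboolP => Nw.
  - by right.
  - by left.
  - by move=> [[]|[]].
  - by move=> [[]|[]].
case: asboolP => Nw; first exact: s1P.
by apply: Abranch => //; exact: DH.
Qed.

End SuslinSelection.

Section SuslinSets.
Context d (T : measurableType d).

Lemma agreeW M N s t : (M <= N)%N -> agree N s t -> agree M s t.
Proof. by move=> MN st i iM; apply: st; exact: leq_trans MN. Qed.

(** Reindexing is continuous on the Baire space: finitely many values of [s \o h] involve finitely
    many values of [s]. *)
Lemma agree_comp (h : nat -> nat) N : exists M, forall s t,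
  agree M s t -> agree N (s \o h) (t \o h).
Proof.
exists (\max_(i < N) (h i).+1)%N => s t st i iN /=.
by apply: st; exact: (leq_bigmax_cond (Ordinal iN)).
Qed.

(* A set of pairs (y, w) obtained from measurable cylinders by Suslin's operation:
   t is the auxiliary sequence over which the union is taken. *)
Definition suslin (E : (nat -> nat) -> set T) : Prop :=
  exists A : nat -> (nat -> nat) -> (nat -> nat) -> set T,
  [/\ forall n y t, measurable (A n y t),
      forall n y t, exists N, forall y' t', agree N y y' -> agree N t t' ->
        A n y' t' = A n y t &
      forall y w, E y w <-> exists t, forall n, A n y t w].

(** The first entry of the auxiliary sequence stores the index of the union, and the tail is the
    auxiliary sequence of that member. *)
Lemma suslin_bigcup (E : nat -> (nat -> nat) -> set T) :
  (forall i, suslin (E i)) -> suslin (fun y => \bigcup_i E i y).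
Proof.
move=> /choice[A AP].
exists (fun n y t => A (t 0%N) n y (fun j => t j.+1)); split=> [n y t|n y t|y w].
- by case: (AP (t 0%N)).
- case: (AP (t 0%N)) => _ + _ => /(_ n y (fun j => t j.+1)) [N NP].
  exists N.+1 => y' t' yy' tt'; rewrite -(tt' 0%N)//; apply: NP.
    exact: agreeW yy'.
  by move=> i iN; exact: tt'.
- split=> [[i _]|[t At]].
    case: (AP i) => _ _ EA /EA[t At].
    by exists (fun j => if j is j'.+1 then t j' else i).
  by exists (t 0%N) => //; case: (AP (t 0%N)) => _ _ ->; exists (fun j => t j.+1).
Qed.

(** A single auxiliary sequence codes one sequence per member, stored in rows by pairing indices;
    the conditions of all members are enumerated by the same pairing. *)
Lemma suslin_bigcap (E : nat -> (nat -> nat) -> set T) :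
  (forall i, suslin (E i)) -> suslin (fun y => \bigcap_i E i y).
Proof.
move=> /choice[A AP].
have [e eK] : exists e : nat -> nat * nat, forall q, e (pickle q) = q.
  by exists (fun m => odflt (0%N, 0%N) (unpickle m)) => q; rewrite pickleK.
pose row (i : nat) (t : nat -> nat) := t \o (fun j : nat => pickle (i, j)).
exists (fun m y t => A (e m).1 (e m).2 y (row (e m).1 t)).
split=> [m y t|m y t|y w].
- by case: (AP (e m).1).
- case: (AP (e m).1) => _ + _ => /(_ (e m).2 y (row (e m).1 t)) [N NP].
  have [M MP] := agree_comp (fun j => pickle ((e m).1, j)) N.
  exists (maxn M N) => y' t' yy' tt'; apply: NP.
    by apply: agreeW yy'; rewrite leq_maxr.
  by apply: MP; apply: agreeW tt'; rewrite leq_maxl.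
- split=> [Ew|[t At] i _].
    have /choice[t tP] : forall i, exists t, forall n, A i n y t w.
      by move=> i; case: (AP i) => _ _ EA; apply/EA/Ew.
    exists (fun m => t (e m).1 (e m).2) => m.
    rewrite (_ : row _ _ = t (e m).1)//.
    by apply/funext => j; rewrite /row /= eK.
  case: (AP i) => _ _ ->; exists (row i t) => n.
  by have := At (pickle (i, n)); rewrite eK.
Qed.

Lemma suslin_cst (B : set T) : measurable B -> suslin (fun=> B).
Proof.
move=> mB; exists (fun _ _ _ => B); split=> // [n y t|y w]; first by exists 0%N.
by split=> [Bw|[_ /(_ 0%N)]] //; exists id.
Qed.

(** The first auxiliary entry guesses the length of a prefix of [y] that already forces membership
    in [U]. *)
Lemma suslin_open (U : set (nat -> nat)) :
  (forall y, U y -> exists N, forall y', agree N y y' -> U y') ->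
  suslin (fun y => [set _ | U y]).
Proof.
move=> Uo.
pose A N y := if `[< forall y', agree N y y' -> U y' >] then [set: T] else set0.
exists (fun _ y t => A (t 0%N) y); split=> [_ y t|_ y t|y w].
- by rewrite /A; case: ifP.
- exists (t 0%N).+1 => y' t' yy' /(_ 0%N isT) <-; rewrite /A.
  congr (if _ then _ else _); apply: asbool_equiv_eq; split=> UN z zz.
    by apply: UN => i iN; rewrite -yy' ?zz//; exact: ltn_trans iN _.
  by apply: UN => i iN; rewrite yy' ?zz//; exact: ltn_trans iN _.
- split=> [/= /Uo[N NP]|[t At]].
    by exists (fun=> N) => _; rewrite /A asboolT.
  by have := At 0%N; rewrite /A; case: asboolP => // UN _; exact: UN.
Qed.

(** Lying outside an open set means that no prefix forces membership, which is a countable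
    conjunction of conditions on finite prefixes. *)
Lemma suslin_closed (U : set (nat -> nat)) :
  (forall y, U y -> exists N, forall y', agree N y y' -> U y') ->
  suslin (fun y => [set _ | ~ U y]).
Proof.
move=> Uo.
pose A N y := if `[< forall y', agree N y y' -> U y' >] then set0 else [set: T].
exists (fun n y t => A n y); split=> [n y t|n y t|y w].
- by rewrite /A; case: ifP.
- exists n => y' t' yy' _; rewrite /A.
  congr (if _ then _ else _); apply: asbool_equiv_eq; split=> UN z zz.
    by apply: UN => i iN; rewrite -yy' ?zz.
  by apply: UN => i iN; rewrite yy' ?zz.
- split=> [/= nU|[t At] /= /Uo[N NP]].
    by exists id => n; rewrite /A; case: asboolP => // /(_ y) Uy; apply/nU/Uy.
  by have := At N; rewrite /A asboolT.
Qed.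

Context (R : realType) (mu : {measure set T -> \bar R}).
Hypothesis mu_fin : (mu setT < +oo)%E.
Hypothesis mu_complete : measure_is_complete mu.

(** Interleave [y] and its auxiliary sequence as the even and odd entries of one branch. Selecting
    this branch measurably selects [y]. *)
Lemma suslin_uniformization (E : (nat -> nat) -> set T) : suslin E ->
  measurable [set w | exists y, E y w] /\
  exists y : T -> nat -> nat, (forall i k, measurable [set w | y w i = k]) /\
    forall w, (exists y, E y w) -> E (y w) w.
Proof.
move=> [A [mA lcA EA]].
pose ev (s : nat -> nat) := s \o double; pose od (s : nat -> nat) := s \o (fun i => i.*2.+1).
have lcA' n : locally_constant (fun s => A n (ev s) (od s)).
  move=> s; have [N NP] := lcA n (ev s) (od s).
  have [M1 P1] := agree_comp double N.
  have [M2 P2] := agree_comp (fun i => i.*2.+1) N.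
  exists (maxn M1 M2) => t st; apply: NP.
    by apply: P1; apply: agreeW st; rewrite leq_maxl.
  by apply: P2; apply: agreeW st; rewrite leq_maxr.
have [mD [s [ms sP]]] :=
  suslin_selection mu_fin mu_complete (fun n s => mA n (ev s) (od s)) lcA'.
have EAE w : (exists y, E y w) <-> exists s, forall n, A n (ev s) (od s) w.
  split=> [[y /EA[t At]]|[z Az]]; last by exists (ev z); apply/EA; exists (od z).
  exists (fun i => if odd i then t i./2 else y i./2) => n.
  rewrite (_ : ev _ = y); last by apply/funext => i; rewrite /ev /= odd_double doubleK.
  rewrite (_ : od _ = t)//.
  by apply/funext => i; rewrite /od /= odd_double /= uphalf_double.
split; first by rewrite (_ : mkset _ = [set w | exists s, forall n, A n (ev s) (od s) w])//;
  apply/seteqP; split=> w /EAE.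
exists (fun w => ev (s w)); split=> [i k|w /EAE/sP Aw]; first exact: ms.
by apply/EA; exists (od (s w)).
Qed.

End SuslinSets.

(** * Row vectors and a parametrization of R^p by integer sequences *)

Section RowVectors.
Context (R : realType) (p : nat).
Implicit Types (v x y : 'rV[R]_p) (c r : R).

Lemma rV_norm_le v c : 0 <= c -> (forall i, `|v ord0 i| <= c) -> `|v| <= c.
Proof.
move=> c0 vc; rewrite /Num.norm /= mx_normrE.
by apply/bigmax_leP; split=> // -[i j] _ /=; rewrite ord1.
Qed.

Lemma entry_le_norm m n (A : 'M[R]_(m, n)) i j : `|A i j| <= `|A|.
Proof.
rewrite [leRHS]/Num.norm /= mx_normrE.
exact: (le_bigmax _ (fun ij : 'I_m * 'I_n => `|A ij.1 ij.2|) (i, j)).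
Qed.

Lemma rV_dense_seq :
  {q : nat -> 'rV[R]_p | forall x r, 0 < r -> exists n, `|q n - x| < r}.
Proof.
exists (fun n => map_mx ratr (odflt 0 (@unpickle 'rV[rat]_p n))) => x r r0.
have /choice[f fP] : forall i, exists f : rat, `|ratr f - x ord0 i| <= r / 2.
  move=> i.
  have [f] := @rat_in_itvoo R (x ord0 i - r / 2) (x ord0 i + r / 2)
    ltac:(by rewrite ltrD2l gtrN// divr_gt0).
  by rewrite in_itv /= => /andP[f1 f2]; exists f; rewrite ltW// ltr_distl f1.
exists (pickle (\row_i f i)); rewrite pickleK /=.
apply: (@le_lt_trans _ _ (r / 2)); last by rewrite ltr_pdivrMr// ltr_pMr// ltr1n.
apply: rV_norm_le => [|i]; first by rewrite divr_ge0 ?ltW.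
by rewrite !mxE.
Qed.

End RowVectors.

Section PolishParametrization.
Context (R : realType) (p : nat).

(* Every sequence of indices is turned into a Cauchy sequence by skipping the
   points of the dense sequence q that would move it too far. *)
Lemma continuous_parametrization : exists g : (nat -> nat) -> 'rV[R]_p,
  (forall x, exists y, g y = x) /\
  forall (U : set 'rV[R]_p), open U ->
    forall y, U (g y) -> exists N, forall y', agree N y y' -> U (g y').
Proof.
have [q qP] := @rV_dense_seq R p.
pose c n : R := n.+1%:R^-1.
(* The allowed steps telescope, so after index n the sequence [z y] moves by at most [c n]. *)
pose rho n := c n - c n.+1.
have rho0 n : 0 < rho n by rewrite subr_gt0 ltf_pV2 ?posrE ?ltr_nat.
have c0 n : 0 < c n by rewrite invr_gt0.
pose z (y : nat -> nat) := fix z n := if n is m.+1 then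
  (if `|q (y m.+1) - z m| <= rho m then q (y m.+1) else z m) else q (y 0%N).
have zS y n : `|z y n.+1 - z y n| <= rho n.
  by rewrite /=; case: ifP => // _; rewrite subrr normr0 ltW.
have zz y n k : `|z y (n + k)%N - z y n| <= c n - c (n + k)%N.
  elim: k => [|k IH]; first by rewrite addn0 !subrr normr0.
  rewrite -(subrKA (z y (n + k)%N)) addnS; apply: le_trans (ler_normD _ _) _.
  apply: le_trans (lerD (zS _ _) IH) _.
  by rewrite addrC /rho addrA subrK.
have zle y n m : (n <= m)%N -> `|z y m - z y n| <= c n.
  by move=> /subnKC <-; apply: le_trans (zz _ _ _) _; rewrite gerBl ltW.
have c_small (e : R) : 0 < e -> exists n, c n < e.
  move=> e0; have /= [n _ ne] := near_infty_natSinv_lt (PosNum e0).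
  by exists n; apply: ne => /=.
have zcvg y : cvgn (z y).
  apply: cauchy_cvg; apply: cauchy_exP => e e0.
  have [n ne] := c_small e e0; exists (z y n), n => //= m nm.
  by rewrite -ball_normE /= distrC; exact: le_lt_trans (zle _ _ _ nm) ne.
have zlim y n : `|limn (z y) - z y n| <= c n.
  apply/ler_addgt0Pr => e e0.
  have /cvgrPdist_lt/(_ e e0)[m _ mP] := zcvg y.
  have := mP (maxn m n) (leq_maxl _ _).
  have := zle y n (maxn m n) (leq_maxr _ _).
  move=> h1 h2; rewrite -(subrKA (z y (maxn m n))) addrC.
  by apply: le_trans (ler_normD _ _) _; rewrite lerD// ltW.
exists (fun y => limn (z y)); split=> [x|U Uo y Uy].
  (* With this accuracy two consecutive approximations of x differ by at most [rho n], half of it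
     coming from each, so no point is skipped and [z y] runs through them all. *)
  pose r n := Num.min (rho n) (rho n.-1) / 2.
  have /choice[y yP] : forall n, exists k, `|q k - x| < r n.
    by move=> n; apply: qP; rewrite divr_gt0// lt_min !rho0.
  have zq n : z y n = q (y n).
    elim: n => [//|n IH] /=; rewrite IH ifT//.
    rewrite -(subrKA x) -[x - _]opprB; apply: le_trans (ler_normB _ _) _.
    rewrite [leRHS]splitr; apply: lerD; (apply: le_trans; first exact/ltW/yP);
      by rewrite /r ler_pM2r ?invr_gt0// ge_min lexx ?orbT.
  exists y; apply/eqP; rewrite -subr_eq0 -normr_le0; apply/ler_addgt0Pr => e e0.
  rewrite add0r; have [n ne] := c_small (e / 2) (divr_gt0 e0 (ltr0Sn _ 1)).
  rewrite -(subrKA (z y n)); apply: le_trans (ler_normD _ _) _.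
  rewrite [leRHS]splitr lerD//; first exact: le_trans (zlim _ _) (ltW ne).
  rewrite zq (le_trans (ltW (yP n)))//; apply: le_trans (ltW ne).
  rewrite /r ler_pdivrMr// ge_min; apply/orP; left.
  by rewrite mulr_natr mulr2n; apply: (@le_trans _ _ (c n));
    rewrite ?gerBl ?lerDl ltW.
have /nbhs_ballP[e /= e0 eU] : nbhs (limn (z y)) U by exact: open_nbhs_nbhs.
have [n ne] := c_small (e / 2) (divr_gt0 e0 (ltr0Sn _ 1)).
(* The entries 0 to n determine [z y n], and both limits lie within [c n], less than half of e, of
   this common point. *)
exists n.+1 => y' yy'; apply: eU; rewrite -ball_normE /=.
have zE m : (m <= n)%N -> z y' m = z y m.
  elim: m => [|m IH] mn /=; first by rewrite yy'.
  by rewrite IH ?(ltnW mn)// yy'.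
rewrite -(subrKA (z y n)) [e]splitr; apply: le_lt_trans (ler_normD _ _) _.
apply: ltrD; first exact: le_lt_trans (zlim _ _) ne.
by rewrite -zE// distrC; exact: le_lt_trans (zlim _ _) ne.
Qed.

End PolishParametrization.

(** * Measurable selection over a complete finite measure *)

Section MeasurableSelection.
Context (R : realType) (p : nat) d (T : measurableType d).
Variable mu : {measure set T -> \bar R}.
Hypothesis mu_fin : (mu setT < +oo)%E.
Hypothesis mu_complete : measure_is_complete mu.

(** The sets that, pulled back along the parametrization [g], are Suslin together with their
    complements form a sigma-algebra containing the generators of the product. Uniformization then
    selects a sequence, which [g] turns into a point. *)
Lemma measurable_selection (E : set (borel_rV R p * T)) : measurable E ->
  measurable [set w | exists x, E (x, w)] /\
  exists s : T -> 'rV[R]_p, (forall U, open U -> measurable (s @^-1` U)) /\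
    forall w, (exists x, E (x, w)) -> E (s w, w).
Proof.
have [g [gsurj gcont]] := continuous_parametrization R p.
pose C (E : set (borel_rV R p * T)) := suslin (fun y => [set w | E (g y, w)]) /\
  suslin (fun y => [set w | ~ E (g y, w)]).
have suslin_ext (E1 E2 : (nat -> nat) -> set T) :
    suslin E1 -> (forall y w, E1 y w <-> E2 y w) -> suslin E2.
  move=> [A [mA lA EA]] E12; exists A; split=> // y w.
  by split=> [/E12/EA|/EA/E12].
have Csigma : sigma_algebra setT C.
  split=> [|A [A1 A2]|A CA].
  - split; first exact: (suslin_cst measurable0).
    by apply: (suslin_ext (fun=> setT)) => [|y w]; [exact: suslin_cst|split=> // _ []].
  - split; first by apply: (suslin_ext _ _ A2) => y w; split=> [|[]].
    apply: (suslin_ext _ _ A1) => y w; split=> [Aw []//|/= nA].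
    by apply: contrapT => ?; apply: nA.
  - split.
      apply: (suslin_ext (fun y => \bigcup_i [set w | A i (g y, w)])) => //.
      by apply: suslin_bigcup => i; case: (CA i).
    apply: (suslin_ext (fun y => \bigcap_i [set w | ~ A i (g y, w)])).
      by apply: suslin_bigcap => i; case: (CA i).
    move=> y w; split=> [nA [i _ Ai]|nA i _ Ai]; first exact: nA Ai.
    by apply: nA; exists i.
have Copen U : open U -> C (fst @^-1` U).
  by move=> /gcont gU; split;
    [exact: (@suslin_open _ T (U \o g))|exact: (@suslin_closed _ T (U \o g))].
have Cfst A : measurable A -> C (fst @^-1` A).
  move=> mA; suff: measurable `<=` [set A | C (fst @^-1` A)] by exact.
  apply: smallest_sub => [|U /Copen//]; case: Csigma => C0 CD CU.
  split=> [|B CB|B CB] /=; first exact: C0.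
    exact: CD CB.
  by rewrite preimage_bigcup; exact: CU.
have Csnd B : measurable B -> C (snd @^-1` B).
  move=> mB; split; first exact: (suslin_cst mB).
  exact: (suslin_cst (measurableC mB)).
move=> mE; have [CE _] : C E.
  suff: measurable `<=` C by exact.
  apply: smallest_sub => // _ [[A mA <-]|[A mA <-]]; rewrite setTI.
    exact: Cfst.
  exact: Csnd.
have [mD [y [my yP]]] := suslin_uniformization mu_fin mu_complete CE.
have DE w : (exists x, E (x, w)) <-> exists y, E (g y, w).
  split=> [[x]|[z Ez]]; last by exists (g z).
  by have [z <-] := gsurj x; exists z.
split.
  by rewrite (_ : mkset _ = [set w | exists y, E (g y, w)])//;
    apply/seteqP; split=> w /DE.
exists (g \o y); split=> [U Uo|w /DE/yP//].
have [e eK] : exists e : nat -> seq nat, forall s, e (pickle s) = s.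
  by exists (fun m => odflt [::] (unpickle m)) => s; rewrite pickleK.
pose cyl s := [set z | agree (size s) (nth 0%N s) z].
(* By continuity of [g] the preimage of [U] is the union of the cylinders that [g] maps into [U],
   and there are only countably many cylinders. *)
rewrite (_ : _ @^-1` _ = \bigcup_(m in [set m | cyl (e m) `<=` g @^-1` U])
    \bigcap_(i in `I_(size (e m))) [set w | nth 0%N (e m) i = y w i]).
  apply: bigcup_measurable => m _; apply: bigcap_measurableType => i _.
  rewrite (_ : mkset _ = [set w | y w i = nth 0%N (e m) i])//.
  by apply/seteqP; split.
apply/seteqP; split=> w; last by move=> [m /= mU mw]; exact: mU.
move=> /= /(gcont _ Uo)[N NP]; exists (pickle (mkseq (y w) N)); rewrite /mkset eK.
  by rewrite /cyl size_mkseq => z zy; apply: NP => i iN; rewrite -zy// nth_mkseq.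
by rewrite size_mkseq => i /= iN; rewrite nth_mkseq.
Qed.

End MeasurableSelection.

(** * The Euclidean norm and estimators nearest to a given point *)

Section EuclideanNorm.
Context (R : realType) (p : nat).
Implicit Types (v x y : 'rV[R]_p) (c : R).

Lemma enorm_ge0 v : 0 <= enorm v. Proof. exact: sqrtr_ge0. Qed.

Lemma norm_le_enorm v : `|v| <= enorm v.
Proof.
apply: rV_norm_le => [|i]; first exact: enorm_ge0.
rewrite -sqrtr_sqr ler_sqrt; last by apply: sumr_ge0 => j _; exact: sqr_ge0.
by rewrite (bigD1 i)//= lerDl; apply: sumr_ge0 => j _; exact: sqr_ge0.
Qed.

Lemma enorm_le_norm v : enorm v <= p.+1%:R * `|v|.
Proof.
rewrite -[leRHS]ger0_norm ?mulr_ge0// -sqrtr_sqr ler_sqrt ?sqr_ge0//.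
apply: (@le_trans _ _ (\sum_(i < p) `|v| ^+ 2)).
  by apply: ler_sum => i _; rewrite -real_normK ?num_real// lerXn2r ?nnegrE ?entry_le_norm.
rewrite sumr_const card_ord exprMn -[leLHS]mulr_natl ler_wpM2r ?sqr_ge0//.
by rewrite -natrX ler_nat (leq_trans (leqnSn p))// -[leqLHS]muln1 leq_mul.
Qed.

Lemma enormZ c v : enorm (c *: v) = `|c| * enorm v.
Proof.
rewrite /enorm -sqrtr_sqr -sqrtrM ?sqr_ge0//; congr Num.sqrt.
by rewrite mulr_sumr; apply: eq_bigr => i _; rewrite mxE exprMn.
Qed.

Lemma enorm0 : enorm (0 : 'rV[R]_p) = 0.
Proof. by rewrite -(scale0r 0) enormZ normr0 mul0r. Qed.

Lemma enorm_continuous : continuous (@enorm R p).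
Proof.
move=> v; apply: (@continuous_comp _ _ _ (fun v => \sum_(i < p) v ord0 i ^+ 2) Num.sqrt);
  last exact: sqrt_continuous.
have ? := nbhs_filter v.
apply: cvg_big => [|i _]; [exact: add_continuous|apply: cvgM; exact: coord_continuous].
Qed.

Lemma scaled_distance_continuous (a : R) x :
  continuous (fun t : 'rV[R]_p => a * enorm (t - x)).
Proof.
move=> t; suff: {for t, continuous ((fun=> a) \* (@enorm R p \o (id - cst x)))} by exact.
apply: continuousM; first exact: cst_continuous.
apply: continuous_comp; last exact: enorm_continuous.
by apply: continuousB; [exact: cvg_id|exact: cst_continuous].
Qed.

End EuclideanNorm.

Section NearestEstimator.
Context d (Omega : measurableType d) (R : realType) (P : probability Omega R).
Context (p : nat) (Theta : set 'rV[R]_p) (F : set (set Omega)).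
Hypothesis Theta_borel : measurable (Theta : set (borel_rV R p)).
Hypothesis F_sub : complete_sub_sigma_field P F.

Lemma sub_measurableE (A : set Omega) :
  measurable (A : set (g_sigma_algebraType F)) <-> F A.
Proof.
case: F_sub => sF _ _.
by rewrite -[X in _ <-> X A](sigma_algebra_id sF).
Qed.

(** The selection theorem is applied to the restriction of [P] to [F], realized as the pushforward
    of [P] along the identity; its completeness is the completeness of [F]. This makes the selection
    measurable for [F] itself. *)
Lemma estimating_function_selection (G : 'rV[R]_p -> Omega -> 'rV[R]_p)
    (B : set (borel_rV R p)) : estimating_function Theta F G -> measurable B ->
  let zero t w := [/\ Theta t, G t w = 0 & B t] in
  F [set w | exists t, zero t w] /\
  exists s : Omega -> 'rV[R]_p, (forall U, open U -> F (s @^-1` U)) /\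
    forall w, (exists t, zero t w) -> zero (s w) w.
Proof.
move=> mG mB zero; case: (F_sub) => sF FM Fc.
pose T' := g_sigma_algebraType F.
have mid : measurable_fun setT (id : Omega -> T').
  by move=> _ A /sub_measurableE FA; rewrite setTI; exact: FM.
pose mu := measure_function_pushforward__canonical__measure_function_Measure P mid.
have mu_fin : (mu setT < +oo)%E.
  by rewrite /mu /= /pushforward preimage_setT probability_setT ltry.
have mu_complete : measure_is_complete mu.
  by move=> N [A [/sub_measurableE FA PA NA]]; apply/sub_measurableE/(Fc A).
pose E : set (borel_rV R p * T') := [set z | zero z.1 z.2].
have mE : measurable E.
  have mT : measurable (Theta `*` [set: T'] : set (borel_rV R p * T')).
    exact: measurableX.
  have m0 : measurable ([set 0] : set (borel_rV R p)).
    rewrite -(setCK [set 0]); apply: measurableC; apply: sub_sigma_algebra.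
    by rewrite /= openC; apply: accessible_closed_set1; apply: hausdorff_accessible;
    exact: norm_hausdorff.
  have mBT : measurable (B `*` [set: T'] : set (borel_rV R p * T')).
    exact: measurableX.
  rewrite (_ : E = ((Theta `*` setT) `&` (fun z => G z.1 z.2) @^-1` [set 0]) `&`
      (B `*` setT)); first by apply: measurableI => //; exact: mG.
  by apply/seteqP; split=> -[t w] /=; [case|case=> -[[? _] ?] []].
have [mD [s [ms sP]]] := measurable_selection mu_fin mu_complete mE.
split; first by apply/sub_measurableE; exact: mD.
by exists s; split=> [U Uo|]; [apply/sub_measurableE; exact: ms|exact: sP].
Qed.

(* Choosing a solution within the least possible integer multiple of 1/a of theta
   gives an estimator that is as close to theta as any other, up to 1/a. *)
Lemma near_optimal_estimator (G : 'rV[R]_p -> Omega -> 'rV[R]_p)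
    (theta : 'rV[R]_p) (a : R) : 0 < a -> estimating_function Theta F G ->
  exists that, is_estimator Theta F G that /\
    forall w t, Theta t -> G t w = 0 ->
      a * dist_delta (that w) theta <= a * enorm (t - theta) + 1.
Proof.
move=> a0 mG.
pose B j : set (borel_rV R p) := [set t | a * enorm (t - theta) <= j%:R].
have mB j : measurable (B j).
  rewrite -(setCK (B j)); apply: measurableC; apply: sub_sigma_algebra.
  rewrite /= openC.
  by have := (continuous_closedP _).1 (@scaled_distance_continuous R p a theta)
    _ (@closed_le _ j%:R).
have /choice[s sP] := fun j => (estimating_function_selection mG (mB j)).2.
pose D j := [set w | exists t, [/\ Theta t, G t w = 0 & B j t]].
have FD j : F (D j) := (estimating_function_selection mG (mB j)).1.
have mD j : measurable (D j : set (g_sigma_algebraType F)).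
  exact/sub_measurableE.
have [f [mf fD fle]] := measurable_least_index mD.
have zD w t : Theta t -> G t w = 0 ->
    D (Num.truncn (a * enorm (t - theta))).+1 w.
  move=> Tt Gt; exists t; split=> //; rewrite /B /=.
  by apply/ltW; apply: truncnS_gt.
pose that w := if `[< (\bigcup_j D j) w >] then Some (s (f w) w) else None.
have thatP w : (\bigcup_j D j) w ->
    [/\ that w = Some (s (f w) w), Theta (s (f w) w), G (s (f w) w) w = 0 & B (f w) (s (f w) w)].
  move=> Dw; rewrite /that asboolT//.
  by have [//] := (sP (f w)).2 w (fD w Dw).
exists that; split.
  split=> [|w [t Tt Gt]|w nS].
  - apply: (@measurability _ _ (g_sigma_algebraType F)
      (g_sigma_algebraType (@open_delta R p)) _ _ (@open_delta R p)) => //.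
    move=> _ [V Vo <-]; rewrite setTI.
    rewrite (_ : that @^-1` V =
      (\bigcup_j (D j `&` [set w | f w = j] `&` s j @^-1` (Some @^-1` V))) `|`
      (if `[< V None >] then ~` (\bigcup_j D j) else set0)).
      apply: measurableU.
        apply: bigcupT_measurable => j; apply: measurableI; first exact: measurableI.
        by apply/sub_measurableE/(sP j).1.
      by case: ifP => // _; apply: measurableC; exact: bigcupT_measurable.
    apply/seteqP; split=> w /=; rewrite /that.
      case: asboolP => Dw Vw; last by right; rewrite asboolT.
      by left; exists (f w) => //; split=> //; split=> //; exact: fD.
    move=> [[j _ [[Dj <-] Vs]]|]; first by rewrite asboolT//; exists j.
    by case: asboolP => // VN nD; rewrite asboolF.
  - have /thatP[e1 e2 e3 _] : (\bigcup_j D j) w by eexists; [by []|exact: zD Gt].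
    by exists (s (f w) w).
  - rewrite /that asboolF// => -[j _ [t [Tt Gt _]]].
    by apply: nS; exists t.
move=> w t Tt Gt; have Dt := zD w t Tt Gt.
have /thatP[-> _ _ /= Bs] : (\bigcup_j D j) w by eexists; [by []|exact: Dt].
(* The least index [f w] is at most that of a ball known to contain [t]; rounding up to this index
   accounts for the extra 1. *)
apply: le_trans Bs _; apply: (@le_trans _ _ (Num.truncn (a * enorm (t - theta))).+1%:R).
  by rewrite ler_nat; exact: fle.
by rewrite -natr1 lerD2r truncn_le// mulr_ge0 ?enorm_ge0// ltW.
Qed.

End NearestEstimator.

(** * Quantitative local inversion *)

Section LocalInversion.
Context (R : realType) (p : nat).
Local Notation V := 'rV[R]_p.
Implicit Types (f g : V -> V) (x y z u : V).

Lemma derive_quotient f z u (e s : R) : differentiable f z -> 0 < e -> 0 < s ->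
  exists h, [/\ 0 < h, h < s &
    `|h^-1 *: (f (h *: u + z) - f z) - 'D_u f z| < e].
Proof.
move=> df e0 s0.
have /cvgrPdist_lt/(_ e e0) := @diff_derivable _ _ _ _ _ u df.
move=> -[/= r r0 rP].
pose h := Num.min r s / 2.
have m0 : 0 < Num.min r s by rewrite lt_min r0.
have h0 : 0 < h by rewrite divr_gt0.
have hm : h < Num.min r s by rewrite ltr_pdivrMr// ltr_pMr// ltr1n.
move: hm; rewrite lt_min => /andP[hr hs]; exists h; split=> //.
rewrite distrC; apply: rP => /=; last by rewrite gt_eqF.
by rewrite sub0r normrN gtr0_norm.
Qed.

Lemma ball_segment x0 (r t : R) x y : `|x - x0| < r -> `|y - x0| < r ->
  0 <= t <= 1 -> `|t *: (x - y) + y - x0| < r.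
Proof.
move=> xr yr /andP[t0 t1].
have -> : t *: (x - y) + y - x0 = t *: (x - x0) + (1 - t) *: (y - x0).
  by apply/rowP => i; rewrite !mxE; ring.
apply: le_lt_trans (ler_normD _ _) _; rewrite !normrZ ger0_norm//.
rewrite ger0_norm ?subr_ge0//.
(* Strictness comes from the first summand, whose weight vanishes only for [t = 0]. *)
have [->|tn0] := eqVneq t 0; first by rewrite mul0r subr0 mul1r add0r.
have -> : r = t * r + (1 - t) * r by rewrite -mulrDl addrC subrK mul1r.
apply: ltr_leD; first by rewrite ltr_pM2l// lt_neqAle eq_sym tn0.
by rewrite ler_wpM2l ?subr_ge0// ltW.
Qed.

(** In the sup norm it suffices to bound each coordinate, and each one obeys the scalar mean value
    theorem along the segment from [y] to [x]. *)
Lemma mean_value_bound f x0 (r c : R) : 0 <= c ->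
  (forall x, `|x - x0| < r ->
     forall u, derivable f x u /\ `|'D_u f x| <= c * `|u|) ->
  forall x y, `|x - x0| < r -> `|y - x0| < r -> `|f x - f y| <= c * `|x - y|.
Proof.
move=> c0 df x y xr yr; apply: rV_norm_le => [|i]; first by rewrite mulr_ge0.
set u := x - y; pose z t := t *: u + y; pose phi (t : R) := f (z t) ord0 i.
have dphi (t : R) : 0 <= t <= 1 -> is_derive t (1 : R) phi (('D_u f (z t)) ord0 i).
  move=> t01; have [dfz _] := df _ (ball_segment xr yr t01) u.
  have cv : (h^-1 *: ((phi \o shift t) (h *: (1 : R)) - phi t)) @[h --> 0^'] -->
      ('D_u f (z t)) ord0 i.
    have := cvg_comp _ _ dfz (@coord_continuous R 1 p ord0 i _).
    apply: cvg_trans; apply: near_eq_cvg; near=> h.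
    rewrite /= !mxE /phi /z /GRing.scale /= mulr1; congr (_ * (f _ _ _ - _)).
    by rewrite addrA; congr (_ + y); apply/esym; exact: scalerDl.
  by apply: DeriveDef; [apply/cvg_ex; eexists; exact: cv|exact: cvg_lim cv].
have cphi : {within `[0, 1], continuous phi}.
  apply: derivable_within_continuous => t; rewrite in_itv /= => t01.
  by have [] := dphi t t01.
have dphi' (t : R) : t \in `]0, 1[ -> is_derive t (1 : R) phi (('D_u f (z t)) ord0 i).
  by rewrite in_itv /= => /andP[t0 t1]; apply: dphi; rewrite !ltW.
have [t] := MVT (@ltr01 R) dphi' cphi.
rewrite in_itv /= => /andP[t0 t1]; rewrite /phi /z scale1r scale0r add0r subrK.
rewrite subr0 mulr1 => E; rewrite !mxE E.
apply: le_trans (entry_le_norm _ _ _) _.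
by apply: (df _ (ball_segment xr yr _) u).2; rewrite !ltW.
Unshelve. all: by end_near.
Qed.

Lemma mulmx_bounded (B : 'M[R]_p) (c : R) : (forall i j, `|B i j| <= c) ->
  forall u, `|u *m B| <= p.+1%:R * c * `|u|.
Proof.
move=> Bc u.
(* For p = 0 there are no entries to force [0 <= c], so this case is treated apart. *)
have [p0|p0] := posnP p.
  have -> : u *m B = 0 by apply/rowP => i; exfalso; move: i; rewrite p0 => -[].
  by have -> : u = 0; [apply/rowP => i; exfalso; move: i; rewrite p0 => -[]|
    rewrite normr0 mulr0].
have c0 : 0 <= c by apply: le_trans (Bc (Ordinal p0) (Ordinal p0)).
apply: rV_norm_le => [|j]; first by rewrite !mulr_ge0.
rewrite mxE; apply: le_trans (ler_norm_sum _ _ _) _.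
apply: (@le_trans _ _ (\sum_(i < p) c * `|u|)).
  apply: ler_sum => i _; rewrite normrM mulrC.
  by apply: ler_pM => //; exact: entry_le_norm.
rewrite sumr_const card_ord -[leLHS]mulr_natl -mulrA ler_wpM2r ?mulr_ge0//.
by rewrite ler_nat.
Qed.

(** The bound makes the kernel of [J] trivial, and for a square matrix this gives invertibility. *)
Lemma unitmx_of_lower_bound (J : 'M[R]_p) (K : R) :
  (forall u, `|u| <= K * `|u *m J|) -> J \in unitmx.
Proof.
move=> JK; rewrite -row_free_unit -kermx_eq0; apply/eqP/row_matrixP => i.
rewrite row0; apply/eqP; rewrite -normr_le0.
have /sub_kermxP kJ : (row i (kermx J) <= kermx J)%MS by exact: row_sub.
by apply: le_trans (JK _) _; rewrite kJ normr0 mulr0.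
Qed.

(* A minimizer of |f| over the closed ball is interior by the lower bound; if f
   did not vanish there, moving in the direction u with f' u = - f would make |f|
   smaller. *)
Lemma zero_in_ball f x0 (r s K : R) : 0 < s -> s < r -> 0 <= K ->
  (forall x, `|x - x0| < r -> differentiable f x) ->
  (forall x y, `|x - x0| < r -> `|y - x0| < r -> `|x - y| <= K * `|f x - f y|) ->
  2 * K * `|f x0| < s ->
  exists2 z, `|z - x0| < r & f z = 0.
Proof.
move=> s0 sr K0 df lbf fs.
pose B := closed_ball x0 s.
have BE x : B x <-> `|x - x0| <= s by rewrite /B closed_ballE//= /closed_ball_ /= distrC.
have Br x : B x -> `|x - x0| < r by move=> /BE xs; exact: le_lt_trans sr.
have Bx0 : B x0 by apply/BE; rewrite subrr normr0; exact: ltW.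
have Bc : compact B.
  apply: bounded_closed_compact; last exact: closed_ball_closed.
  exists (`|x0| + s); split; first exact: num_real.
  move=> c cs x /BE xs /=; rewrite -(subrK x0 x).
  by rewrite (le_trans (ler_normD _ _))// (le_trans _ (ltW cs))// addrC lerD2l.
have cf : {within B, continuous (fun x => `|f x|)}.
  apply: continuous_in_subspaceT => x /set_mem /Br/df/differentiable_continuous fc.
  by apply: (@continuous_comp _ _ _ f (fun v : V => `|v|)) => //; exact: norm_continuous.
have [z /set_mem zB zmin] := compact_EVT_min (ex_intro _ x0 Bx0) Bc cf.
have {}zmin x : B x -> `|f z| <= `|f x| by move=> /mem_set/zmin.
have zs : `|z - x0| < s.
  apply: le_lt_trans (lbf _ _ (Br _ zB) (Br _ Bx0)) _; apply: le_lt_trans fs.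
  rewrite [2 * K]mulrC -mulrA ler_wpM2l//.
  apply: le_trans (ler_normB _ _) _; rewrite mulr_natl mulr2n.
  by rewrite lerD2r zmin.
exists z; first exact: Br.
have dfz := df z (Br _ zB).
apply/eqP; rewrite -normr_le0 leNgt; apply/negP => fz0.
(* The minimizer is at distance less than s from [x0], which leaves room for a small step in any
   direction; the added 1 keeps the denominator positive when [u = 0]. *)
have near_ball u h : 0 < h -> h < (s - `|z - x0|) / (`|u| + 1) -> B (h *: u + z).
  move=> h0; rewrite ltr_pdivlMr; last by rewrite ltr_wpDl.
  move=> hu; apply/BE.
  rewrite -addrA; apply: le_trans (ler_normD _ _) _.
  rewrite normrZ gtr0_norm// -lerBrDr; apply: le_trans (ltW hu).
  by rewrite ler_pM2l// lerDl.
have d0 u : 0 < (s - `|z - x0|) / (`|u| + 1).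
  by rewrite divr_gt0 ?subr_gt0// ltr_wpDl.
(* The lower bound for [f], applied to difference quotients, passes to the directional derivative.
   The tolerance is divided by [K + 1] because [K] may be 0. *)
have Junit : jacobian f z \in unitmx.
  apply: (@unitmx_of_lower_bound _ K) => u; rewrite -deriveEjacobian//.
  apply/ler_addgt0Pr => e e0.
  have e1 : 0 < e / (K + 1) by rewrite divr_gt0// ltr_wpDl.
  have [h [h0 hs hD]] := derive_quotient u dfz e1 (d0 u).
  have := lbf _ _ (Br _ (near_ball u h h0 hs)) (Br _ zB).
  rewrite addrK normrZ gtr0_norm// mulrC -ler_pdivlMr// => /le_trans; apply.
  rewrite -mulrA; set q := f _ - f z in hD *.
  have -> : `|q| / h = `|h^-1 *: q|.
    by rewrite normrZ gtr0_norm ?invr_gt0// mulrC.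
  apply: (@le_trans _ _ (K * (`|'D_u f z| + e / (K + 1)))).
    rewrite ler_wpM2l// -lerBlDl; apply: le_trans (ltW hD).
    exact: lerB_dist.
  rewrite mulrDr lerD2l mulrCA; apply: ler_piMr; first exact: ltW.
  by rewrite ler_pdivrMr ?mul1r ?lerDl// ltr_wpDl.
pose u := - f z *m invmx (jacobian f z).
have Du : 'D_u f z = - f z.
  by rewrite deriveEjacobian// /u -mulmxA mulVmx// mulmx1.
have m0 : 0 < Num.min 1 ((s - `|z - x0|) / (`|u| + 1)) by rewrite lt_min ltr01 d0.
have [h [h0]] := derive_quotient u dfz fz0 m0.
rewrite lt_min => /andP[h1 hs]; rewrite Du opprK => hD.
have /zmin := near_ball u h h0 hs; apply/negP; rewrite -ltNge.
set q := f _ - f z in hD.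
(* To first order the step multiplies [f z] by [1 - h]; the error has norm less than [h] times that
   of [f z], so the norm of [f] strictly decreases. *)
have -> : f (h *: u + z) = (1 - h) *: f z + h *: (h^-1 *: q + f z).
  rewrite scalerDr scalerA mulfV ?gt_eqF// scale1r addrCA.
  by rewrite -scalerDl subrK scale1r subrK.
apply: le_lt_trans (ler_normD _ _) _.
rewrite !normrZ (gtr0_norm h0) ger0_norm ?subr_ge0 ?(ltW h1)//.
have : h * `|h^-1 *: q + f z| < h * `|f z| by rewrite ltr_pM2l.
by rewrite mulrBl mul1r; lra.
Qed.

(* [f' = g' + (f' - g')] with the second term small, hence f inherits half of the
   lower bound of g. *)
Lemma lower_bound_perturbation f g x0 (r K : R) : 0 < K ->
  (forall x, `|x - x0| < r -> [/\ differentiable f x, differentiable g x &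
    forall u, `|u *m (jacobian f x - jacobian g x)| <= (2 * K)^-1 * `|u|]) ->
  (forall x y, `|x - x0| < r -> `|y - x0| < r -> `|x - y| <= K * `|g x - g y|) ->
  forall x y, `|x - x0| < r -> `|y - x0| < r -> `|x - y| <= 2 * K * `|f x - f y|.
Proof.
move=> K0 dfg lbg x y xr yr.
have c0 : 0 <= (2 * K)^-1 by rewrite invr_ge0 mulr_ge0// ltW.
have := @mean_value_bound (f - g) x0 r _ c0 _ x y xr yr.
have dB z : `|z - x0| < r -> forall u, derivable (f - g) z u /\
    `|'D_u (f - g) z| <= (2 * K)^-1 * `|u|.
  move=> /dfg[df dg bd] u.
  have fd := @diff_derivable _ _ _ _ _ u df.
  have gd := @diff_derivable _ _ _ _ _ u dg.
  split; first exact: derivableB.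
  by rewrite deriveB// !deriveEjacobian// -mulmxBr.
move=> /(_ dB); rewrite -(ler_pM2l (mulr_gt0 (ltr0Sn R 1) K0)) mulrA mulfV ?gt_eqF ?mulr_gt0//.
rewrite mul1r => h; have := lbg x y xr yr.
have : `|g x - g y| <= `|f x - f y| + `|(f - g) x - (f - g) y|.
  have -> : g x - g y = (f x - f y) - ((f - g) x - (f - g) y).
    by rewrite !fctE; apply/rowP => i; rewrite !mxE; ring.
  exact: ler_normB.
move=> /(ler_wpM2l (ltW K0)); rewrite mulrDr.
lra.
Qed.

(** Near [x0], [g] is its linearization plus a remainder with small derivative, and the remainder
    absorbs at most half of the lower bound coming from the inverse matrix. One integer gives both
    radius and constant, so that the corresponding events form a sequence. *)
Lemma local_lower_bound g x0 (M : set V) : open M -> M x0 ->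
  continuously_differentiable_on M g -> jacobian g x0 \in unitmx ->
  exists k : nat, forall x y, `|x - x0| < k.+1%:R^-1 -> `|y - x0| < k.+1%:R^-1 ->
    `|x - y| <= k.+1%:R * `|g x - g y|.
Proof.
move=> Mo Mx0 gM Ju; set A := jacobian g x0.
pose l := p.+1%:R * `|invmx A| + 1.
have l0 : 0 < l by rewrite ltr_wpDl// mulr_ge0.
have lA u : `|u| <= l * `|u *m A|.
  rewrite -{1}[u]mulmx1 -(mulmxV Ju) mulmxA.
  apply: le_trans (mulmx_bounded (entry_le_norm _) _) _.
  by rewrite ler_wpM2r// lerDl.
(* Entries of size at most [e] give, through [mulmx_bounded], an operator bound of [(2 * l)^-1]. *)
pose e := (p.+1%:R * (2 * l))^-1.
have e0 : 0 < e by rewrite invr_gt0 !mulr_gt0.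
have [_ /cvgrPdist_lt/(_ e e0)] := gM _ Mx0.
move=> /nbhs_ballP[r1 /= r10 r1P].
have /nbhs_ballP[r2 /= r20 r2P] : nbhs x0 M by exact: open_nbhs_nbhs.
have [k kP] : exists k : nat, [/\ k.+1%:R^-1 < r1, k.+1%:R^-1 < r2 & 2 * l <= k.+1%:R].
  have m0 : 0 < Num.min (Num.min r1 r2) (2 * l)^-1.
    by rewrite !lt_min r10 r20 invr_gt0 mulr_gt0.
  have /= [k _ kP] := near_infty_natSinv_lt (PosNum m0).
  exists k; have := kP k (leqnn k); rewrite /= !lt_min => /andP[/andP[-> ->]].
  by rewrite ltf_pV2 ?posrE ?mulr_gt0// => /ltW.
case: kP => k1 k2 kl; exists k => x y xk yk.
have dA z u : is_derive z u (mulmx^~ A) (u *m A).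
  have cv : (h^-1 *: (((mulmx^~ A) \o shift z) (h *: u) - z *m A)) @[h --> 0^'] -->
      u *m A.
    apply: (@cvg_trans _ (u *m A @[h --> (0 : R)^'])); last exact: cvg_cst.
    apply: near_eq_cvg; near=> h.
    rewrite /= mulmxDl addrK -scalemxAl scalerA mulVf ?scale1r//.
    by near: h; exact: nbhs_dnbhs_neq.
  by apply: DeriveDef; [apply/cvg_ex; eexists; exact: cv|exact: cvg_lim cv].
have c0 : 0 <= (2 * l)^-1 by rewrite invr_ge0 mulr_ge0// ltW.
have := @mean_value_bound (g - mulmx^~ A) x0 k.+1%:R^-1 _ c0 _ x y xk yk.
have dB z : `|z - x0| < k.+1%:R^-1 -> forall u, derivable (g - mulmx^~ A) z u /\
    `|'D_u (g - mulmx^~ A) z| <= (2 * l)^-1 * `|u|.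
  move=> zk u; have Mz : M z.
    by apply: r2P; rewrite -ball_normE /= distrC; exact: lt_trans k2.
  have [dg _] := gM _ Mz; have gd := @diff_derivable _ _ _ _ _ u dg.
  have [Ad AE] := dA z u.
  split; first exact: derivableB.
  rewrite deriveB// deriveEjacobian// AE -mulmxBr.
  have -> : (2 * l)^-1 = p.+1%:R * e by rewrite /e [in RHS]invfM mulrA mulfV ?mul1r// pnatr_eq0.
  apply: mulmx_bounded => i j; apply: le_trans (ltW (r1P z _)); last first.
    by rewrite -ball_normE /= distrC; exact: lt_trans k1.
  rewrite -normrN opprB; exact: entry_le_norm.
move=> /(_ dB); rewrite -(ler_pM2l (mulr_gt0 (ltr0Sn R 1) l0)) mulrA mulfV ?gt_eqF ?mulr_gt0//.
rewrite mul1r => h; have := lA (x - y).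
have : `|(x - y) *m A| <= `|g x - g y| + `|(g - mulmx^~ A) x - (g - mulmx^~ A) y|.
  have -> : (x - y) *m A = (g x - g y) - ((g - mulmx^~ A) x - (g - mulmx^~ A) y).
    by rewrite !fctE mulmxBl; apply/rowP => i; rewrite !mxE; ring.
  exact: ler_normB.
move=> /(ler_wpM2l (ltW l0)); rewrite mulrDr => h1 h2.
apply: (@le_trans _ _ (2 * l * `|g x - g y|)); last by rewrite ler_wpM2r.
lra.
Unshelve. all: by end_near.
Qed.

End LocalInversion.

(** * The operator norm and measurability of Jacobians *)

Section OperatorNorm.
Context (R : realType) (p : nat).
Implicit Types (A : 'M[R]_p) (u : 'rV[R]_p).

Lemma opnorm_has_sup A :
  has_sup [set enorm (v *m A) | v in [set v : 'rV[R]_p | enorm v <= 1]].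
Proof.
split; first by exists (enorm (0 *m A)), 0 => //=; rewrite enorm0.
exists (p.+1%:R * (p.+1%:R * `|A|)) => _ [v /= v1 <-].
apply: le_trans (enorm_le_norm _) _; rewrite ler_wpM2l//.
apply: le_trans (mulmx_bounded (entry_le_norm A) v) _.
by rewrite ler_piMr ?mulr_ge0//; exact: le_trans (norm_le_enorm _) v1.
Qed.

Lemma opnorm_bound A u : enorm (u *m A) <= opnorm A * enorm u.
Proof.
have [u0|u0] := eqVneq (enorm u) 0.
  have /eqP : `|u| = 0 by apply/le_anti; rewrite normr_ge0 -u0 norm_le_enorm.
  by rewrite normr_eq0 => /eqP ->; rewrite mul0mx enorm0 mulr0.
have u1 : 0 < enorm u by rewrite lt_neqAle eq_sym u0 enorm_ge0.
rewrite -ler_pdivrMr//.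
have -> : enorm (u *m A) / enorm u = enorm (((enorm u)^-1 *: u) *m A).
  by rewrite -scalemxAl enormZ gtr0_norm ?invr_gt0// mulrC.
apply: sup_upper_bound; first exact: opnorm_has_sup.
exists ((enorm u)^-1 *: u) => //=.
by rewrite enormZ gtr0_norm ?invr_gt0// mulVf.
Qed.

(** A single vector witnesses that the supremum exceeds [e]; the homogeneous form is an open
    condition on [u], which can then be tested on a dense sequence. *)
Lemma lt_opnormP A (e : R) : 0 <= e ->
  e < opnorm A <-> exists u, e * enorm u < enorm (u *m A).
Proof.
move=> e0; split=> [|[u eu]].
  move=> /(sup_gt (opnorm_has_sup A).1)[_ [v /= v1 <-] ev]; exists v.
  by apply: le_lt_trans ev; rewrite ler_piMr.
have := lt_le_trans eu (opnorm_bound A u).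
have := enorm_ge0 u; rewrite le_eqVlt => /orP[/eqP <-|u0]; last by rewrite ltr_pM2r.
by rewrite !mulr0 ltxx.
Qed.

Lemma cvg_enorm_mulmx {T} {F : set_system T} {FF : Filter F}
    (u : T -> 'rV[R]_p) (A : T -> 'M[R]_p) u0 A0 :
  u @ F --> u0 -> A @ F --> A0 ->
  enorm (u t *m A t) @[t --> F] --> enorm (u0 *m A0).
Proof.
move=> uF AF; rewrite /enorm.
apply: (@cvg_comp _ _ _ (fun t => \sum_(j < p) (u t *m A t) ord0 j ^+ 2) Num.sqrt);
  last exact: sqrt_continuous.
have cvj j : (u t *m A t) ord0 j @[t --> F] --> (u0 *m A0) ord0 j.
  under eq_fun do rewrite mxE.
  rewrite mxE; apply: cvg_big => [|i _]; first exact: add_continuous.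
  apply: cvgM.
    exact: (cvg_comp _ _ uF (@coord_continuous R 1 p ord0 i u0)).
  exact: (cvg_comp _ _ AF (@coord_continuous R p p i j A0)).
by apply: cvg_big => [|j _]; [exact: add_continuous|apply: cvgM; exact: cvj].
Qed.

End OperatorNorm.

Section VectorMeasurability.
Context d (T : measurableType d) (R : realType) (p : nat).
Implicit Types X Y : T -> 'rV[R]_p.

Definition coord_measurable X :=
  forall i, measurable_fun [set: T] (fun w => X w ord0 i).

Lemma measurable_coord X :
  measurable_fun [set: T] (X : T -> borel_rV R p) -> coord_measurable X.
Proof.
move=> mX i; apply: (measurability _ (RGenOpens.measurableE R)).
move=> _ [_ [a [b ->]] <-]; rewrite setTI.
have := mX measurableT ((fun v : 'rV[R]_p => v ord0 i) @^-1` `]a, b[%classic).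
rewrite setTI; apply; apply: sub_sigma_algebra.
by apply: open_comp; [move=> v _; exact: coord_continuous|exact: interval_open].
Qed.

Lemma coord_measurableB X Y : coord_measurable X -> coord_measurable Y ->
  coord_measurable (fun w => X w - Y w).
Proof.
move=> mX mY i; under eq_fun do rewrite !mxE.
exact: measurable_funB.
Qed.

Lemma coord_measurableZ (c : R) X : coord_measurable X ->
  coord_measurable (fun w => c *: X w).
Proof.
move=> mX i; under eq_fun do rewrite !mxE.
exact: measurable_funM.
Qed.

Lemma measurable_enorm X : coord_measurable X ->
  measurable_fun [set: T] (fun w => enorm (X w)).
Proof.
move=> mX; rewrite /enorm.
have ms : measurable_fun [set: R] (Num.sqrt : R -> R).
  by apply: continuous_measurable_fun; exact: sqrt_continuous.
apply: (measurableT_comp ms).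
by apply: measurable_sum => i; apply: measurable_funX; exact: mX.
Qed.

Lemma measurable_ltr_set (D : set T) (f : T -> R) (c : R) : measurable D ->
  measurable_fun D f -> measurable (D `&` [set w | c < f w]).
Proof.
move=> mD mf.
have := mf mD `]c, +oo[%classic (measurable_itv _).
congr (measurable (_ `&` _)); apply/seteqP.
by split=> w /=; rewrite in_itv /= andbT.
Qed.

End VectorMeasurability.

Section JacobianMeasurability.
Context d (T : measurableType d) (R : realType) (p : nat).
Local Notation V := 'rV[R]_p.

Lemma rV_dense_nbhs : exists q : nat -> V,
  forall (x : V) (U : set V), nbhs x U -> exists n, U (q n).
Proof.
have [q qP] := @rV_dense_seq R p; exists q => x U /nbhs_ballP[r /= r0 rU].
have [n qn] := qP x r r0; exists n; apply: rU.
by rewrite -ball_normE /= distrC.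
Qed.

(** The directional derivative is a pointwise limit of difference quotients along a fixed sequence
    of steps. The shift by [c] keeps all the points used inside [M], where measurability is
    known. *)
Lemma measurable_enorm_derive (H : V -> T -> V) (M : set V) (D : set T) q u :
  open M -> M q -> (forall x, M x -> coord_measurable (H x)) ->
  measurable D -> (forall w, D w -> derivable (H ^~ w) q u) ->
  measurable_fun D (fun w => enorm ('D_u (H ^~ w) q)).
Proof.
move=> Mo Mq mH mD dH.
have [c cM] : exists c, forall m, M ((m + c).+1%:R^-1 *: u + q).
  have /nbhs_ballP[r /= r0 rM] : nbhs q M by exact: open_nbhs_nbhs.
  have u1 : 0 < `|u| + 1 by rewrite ltr_wpDl.
  have ru : 0 < r / (`|u| + 1) by rewrite divr_gt0.
  have /= [c _ cP] := near_infty_natSinv_lt (PosNum ru).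
  exists c => m; apply: rM; rewrite -ball_normE /= opprD addrCA subrr addr0 normrN.
  rewrite normrZ gtr0_norm ?invr_gt0//.
  have /= := cP (m + c)%N (leq_addl _ _); rewrite ltr_pdivlMr//.
  by apply: le_lt_trans; rewrite ler_pM2l ?invr_gt0// lerDl.
pose t (m : nat) : R := (m + c).+1%:R^-1.
have t0 m : 0 < t m by rewrite invr_gt0.
have tcvg : t @ \oo --> (0 : R)^'.
  move=> /= U [r /= r0 rU].
  have /= [k _ kP] := near_infty_natSinv_lt (PosNum r0).
  exists k => // m /= km; apply: rU => /=; last by rewrite gt_eqF ?t0.
  rewrite sub0r normrN gtr0_norm//; apply: kP => /=.
  by apply: leq_trans km _; rewrite leq_addr.
apply: (@measurable_fun_cvg _ _ _ _
  (fun m w => enorm ((t m)^-1 *: (H (t m *: u + q) w - H q w)))) => [m|w Dw].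
  apply: measurable_funTS; apply: measurable_enorm; apply: coord_measurableZ.
  by apply: coord_measurableB; [apply: mH; exact: cM|exact: mH].
exact: (cvg_comp _ _ (cvg_comp _ _ tcvg (dH w Dw)) (@enorm_continuous _ _ _)).
Qed.

End JacobianMeasurability.

Section JacobianDeviation.
Context d (T : measurableType d) (R : realType) (p : nat).
Local Notation V := 'rV[R]_p.
Variable mu : {measure set T -> \bar R}.
Hypothesis mu_complete : measure_is_complete mu.
Variables (M : set V) (f g : V -> T -> V).
Hypothesis M_open : open M.
Hypothesis mf : forall x, M x -> coord_measurable (f x).
Hypothesis mg : forall x, M x -> coord_measurable (g x).
Hypothesis C1_ae : {ae mu, forall w, continuously_differentiable_on M (f ^~ w) /\
  continuously_differentiable_on M (g ^~ w)}.

Let J w x := jacobian (f ^~ w) x - jacobian (g ^~ w) x.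

(* Both the parameter and the direction can be restricted to countable dense sets,
   because the set of pairs (x, u) with e * enorm u < enorm (u *m J w x) is open. *)
Lemma measurable_jacobian_deviation (e : R) : 0 <= e ->
  measurable [set w | (e%:E < ereal_sup [set (opnorm (J w x))%:E | x in M])%E].
Proof.
move=> e0; have [N [mN N0 NP]] := C1_ae.
have CN w : ~ N w -> continuously_differentiable_on M (f ^~ w) /\
    continuously_differentiable_on M (g ^~ w).
  by move=> nN; apply: contrapT => nC; apply: nN; exact: NP.
have [q qP] := @rV_dense_nbhs R p.
pose Q i j := if `[< M (q i) >] then
  ~` N `&` [set w | e * enorm (q j) < enorm ('D_(q j) (fun x => f x w - g x w) (q i))]
  else set0.
have dfg w x u : ~ N w -> M x -> derivable (fun x => f x w - g x w) x u /\
    'D_u (fun x => f x w - g x w) x = u *m J w x.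
  move=> nN Mx; have [/(_ x Mx)[df _] /(_ x Mx)[dg _]] := CN w nN.
  have fd := @diff_derivable _ _ _ _ _ u df; have gd := @diff_derivable _ _ _ _ _ u dg.
  split; first exact: (derivableB fd gd).
  rewrite /J mulmxBr.
  transitivity ('D_u (f ^~ w) x - 'D_u (g ^~ w) x); first exact: (deriveB fd gd).
  by congr (_ - _); exact: deriveEjacobian.
have mQ i j : measurable (Q i j).
  rewrite /Q; case: asboolP => // Mq; apply: measurable_ltr_set.
    exact: measurableC.
  apply: (measurable_enorm_derive M_open Mq) => [x Mx||w nN].
  - by apply: coord_measurableB; [exact: mf|exact: mg].
  - exact: measurableC.
  - by have [] := dfg w (q i) (q j) nN Mq.
set S := mkset _.
have SQ : S `&` ~` N = \bigcup_i \bigcup_j Q i j.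
  apply/seteqP; split=> w.
    move=> [/ereal_sup_gt[_ [x Mx <-]] + nN]; rewrite lte_fin => /(lt_opnormP _ e0)[u eu].
    (* The direction is moved to the dense sequence first, at fixed [x]; then the point is moved, at
       the new fixed direction. *)
    have [j ej] : exists j, e * enorm (q j) < enorm (q j *m J w x).
      apply: (qP u [set v | e * enorm v < enorm (v *m J w x)]).
      have cv : enorm (v *m J w x) - e * enorm v @[v --> u] --> enorm (u *m J w x) - e * enorm u.
        have h1 : enorm (v *m J w x) @[v --> u] --> enorm (u *m J w x).
          have ? := nbhs_filter u.
          by apply: cvg_enorm_mulmx; [exact: cvg_id|exact: cvg_cst].
        have h2 : e * enorm v @[v --> u] --> e * enorm u.
          have ? := nbhs_filter u.
          by apply: cvgM; [exact: cvg_cst|exact: enorm_continuous].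
        exact: (cvgB h1 h2).
      have : 0 < enorm (u *m J w x) - e * enorm u by rewrite subr_gt0.
      move=> /(cvgr_gt _ cv); apply: filterS => v /=.
      by rewrite subr_gt0.
    have [i [Mi ei]] : exists i, M (q i) /\ e * enorm (q j) < enorm (q j *m J w (q i)).
      apply: (qP x [set y | M y /\ e * enorm (q j) < enorm (q j *m J w y)]).
      have [fM gM] := CN w nN.
      have cv : enorm (q j *m J w y) @[y --> x] --> enorm (q j *m J w x).
        have ? := nbhs_filter x; apply: cvg_enorm_mulmx; first exact: cvg_cst.
        exact: (cvgB (fM x Mx).2 (gM x Mx).2).
      have := cvgr_gt _ cv _ ej; move=> near_e.
      have near_M : nbhs x M by exact: open_nbhs_nbhs.
      exact: (filterI near_M (near_e _)).
    exists i => //; exists j => //; rewrite /Q asboolT//; split=> //=.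
    by have [_ ->] := dfg w (q i) (q j) nN Mi.
  move=> [i _ [j _]]; rewrite /Q; case: asboolP => // Mi [nN /=].
  have [_ ->] := dfg w (q i) (q j) nN Mi => eq.
  split=> //; rewrite /S /=; apply: (@lt_le_trans _ _ (opnorm (J w (q i)))%:E).
    by rewrite lte_fin; apply/(lt_opnormP _ e0); exists (q j).
  by apply: ereal_sup_ubound; exists (q i).
(* Outside [N] the set is a countable union of measurable sets; its part inside [N] is negligible,
   hence measurable by completeness. *)
rewrite -(setIT S) -(setvU N) setIUr SQ; apply: measurableU.
  by apply: bigcupT_measurable => i; exact: bigcupT_measurable.
apply: mu_complete; exists N; split=> //; exact: subIsetr.
Qed.

End JacobianDeviation.

(** * Bounds that hold off events of small probability *)

Section SmallProbability.
Context d (Omega : measurableType d) (R : realType) (P : probability Omega R).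

Lemma cvg0_near_lt (B : (set Omega)^nat) (e : R) : 0 < e ->
  P (B n) @[n --> \oo] --> 0%E -> \forall n \near \oo, (P (B n) < e%:E)%E.
Proof.
move=> e0 /fine_cvgP[fB] /cvgrPdist_lt /(_ e e0); apply: filterS2 fB => n fn.
rewrite sub0r normrN ger0_norm ?fine_ge0// => h.
by rewrite -(@fineK _ (P (B n)))// lte_fin.
Qed.

Lemma nonincreasing_near_lt (B : (set Omega)^nat) (e : R) : 0 < e ->
  (forall k, measurable (B k)) -> {homo B : n m / (n <= m)%N >-> (m <= n)%O} ->
  P (\bigcap_k B k) = 0%E -> \forall k \near \oo, (P (B k) < e%:E)%E.
Proof.
move=> e0 mB ninc B0; apply: cvg0_near_lt => //.
rewrite -B0; apply: nonincreasing_cvg_mu => //; last exact: bigcapT_measurable.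
by apply: le_lt_trans (ltry 1); exact: probability_le1.
Qed.

End SmallProbability.

Section HighProbabilityLowerBound.
Context d (T : measurableType d) (R : realType) (p : nat).
Local Notation V := 'rV[R]_p.
Variable P : probability T R.

(** The events that the bound with index k fails at some pair of dense points decrease in k, and by
    [local_lower_bound] their intersection is null. Continuity of the measure from above then makes
    one deterministic k good enough. *)
Lemma lower_bound_event (M : set V) (x0 : V) (g : V -> T -> V) :
  open M -> M x0 -> (forall x, M x -> coord_measurable (g x)) ->
  {ae P, forall w, continuously_differentiable_on M (g ^~ w)} ->
  {ae P, forall w, jacobian (g ^~ w) x0 \in unitmx} ->
  forall e : R, 0 < e -> exists r K (B : set T),
    [/\ 0 < r, 0 < K, (forall x, `|x - x0| < r -> M x) &
      [/\ measurable B, (P B < e%:E)%E & forall w, ~ B w -> forall x y,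
         `|x - x0| < r -> `|y - x0| < r -> `|x - y| <= K * `|g x w - g y w|]].
Proof.
move=> Mo Mx0 mg C1 Ju e e0.
have [N [mN N0 NP]] : {ae P, forall w, continuously_differentiable_on M (g ^~ w) /\
    jacobian (g ^~ w) x0 \in unitmx}.
  by move: C1 Ju; apply: filterS2 => w.
have CN w : ~ N w -> continuously_differentiable_on M (g ^~ w) /\
    jacobian (g ^~ w) x0 \in unitmx.
  by move=> nN; apply: contrapT => nC; apply: nN; exact: NP.
have [q qP] := @rV_dense_nbhs R p.
pose O k : set V := [set x | `|x - x0| < k.+1%:R^-1 /\ M x].
(* A positive gap is a violation of the bound. The Euclidean norm dominates the sup norm, so the gap
   is nonpositive wherever the sup norm bound holds. *)
pose gap k x y w := `|x - y| - k.+1%:R * enorm (g x w - g y w).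
pose Q k i j := if `[< O k (q i) /\ O k (q j) >] then
  [set: T] `&` [set w | 0 < gap k (q i) (q j) w] else set0.
have mQ k i j : measurable (Q k i j).
  rewrite /Q; case: asboolP => // -[[_ Mi] [_ Mj]]; apply: measurable_ltr_set => //.
  apply: measurable_funB => //; apply: measurable_funM => //.
  by apply: measurable_enorm; apply: coord_measurableB; exact: mg.
pose B k := \bigcup_i \bigcup_j Q k i j `|` N.
have mB k : measurable (B k).
  apply: measurableU => //.
  by apply: bigcupT_measurable => i; exact: bigcupT_measurable.
have ninc : {homo B : n m / (n <= m)%N >-> (m <= n)%O}.
  move=> m n mn; apply/subsetPset => w [[i _ [j _ Qw]]|]; [left|by right].
  exists i => //; exists j => //; move: Qw; rewrite /Q.
  have O_mono x : O n x -> O m x.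
    move=> [xn Mx]; split=> //; apply: lt_le_trans xn _.
    by rewrite lef_pV2 ?posrE// ler_nat.
  case: asboolP => // -[Oi Oj] [_ /= gapn]; rewrite asboolT; last by split; exact: O_mono.
  split=> //=; apply: lt_le_trans gapn _.
  by rewrite /gap lerD2l lerN2 ler_wpM2r ?enorm_ge0// ler_nat.
have Bcap : P (\bigcap_k B k) = 0%E.
  apply: measure_negligible; first exact: bigcapT_measurable.
  exists N; split=> // w Bw; apply: contrapT => nN.
  have [gC gu] := CN w nN.
  have [k kP] := local_lower_bound Mo Mx0 gC gu.
  have [[i _ [j _]]|//] := Bw k I; rewrite /Q; case: asboolP => // -[[xi _] [xj _]] [_ /=].
  rewrite /gap subr_gt0 ltNge => /negP; apply.
  by apply: le_trans (kP _ _ xi xj) _; rewrite ler_wpM2l// norm_le_enorm.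
have /nbhs_ballP[r /= r0 rM] : nbhs x0 M by exact: open_nbhs_nbhs.
have /= [k0 _ k0P] := near_infty_natSinv_lt (PosNum r0).
have [k1 _ k1P] := nonincreasing_near_lt e0 mB ninc Bcap.
pose k := maxn k0 k1.
have kr : k.+1%:R^-1 < r by apply: (k0P k); exact: leq_maxl.
have kM x : `|x - x0| < k.+1%:R^-1 -> M x.
  by move=> xk; apply: rM; rewrite -ball_normE /= distrC; exact: lt_trans kr.
(* The factor [p.+1] pays for returning from the Euclidean norm to the sup norm. *)
exists k.+1%:R^-1, (k.+1%:R * p.+1%:R), (B k).
split; rewrite ?mulr_gt0 ?invr_gt0//; split=> //.
  by apply: k1P; exact: leq_maxr.
move=> w nB x y xk yk; apply: (@le_trans _ _ (k.+1%:R * enorm (g x w - g y w))); last first.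
  by rewrite -mulrA ler_wpM2l//; exact: enorm_le_norm.
(* A violation at [(x, y)] persists nearby by continuity, so it carries over to dense points,
   replacing first [x] and then [y]. *)
rewrite leNgt -subr_gt0; apply/negP => gap0; apply: (nB); left.
have nN : ~ N w by move=> Nw; apply: nB; right.
have [gC _] := CN w nN.
have Oo x1 : `|x1 - x0| < k.+1%:R^-1 -> nbhs x1 (O k).
  move=> x1k; have bo : nbhs x1 (ball x0 k.+1%:R^-1).
    apply: open_nbhs_nbhs; split; first exact: ball_open.
    by rewrite -ball_normE /= distrC.
  have Mn : nbhs x1 M by apply: open_nbhs_nbhs; split=> //; exact: kM.
  by apply: filterS2 bo Mn => z; rewrite -ball_normE /= distrC.
have gc x1 : `|x1 - x0| < k.+1%:R^-1 -> {for x1, continuous (g ^~ w)}.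
  by move=> x1k; apply: differentiable_continuous; exact: (gC _ (kM _ x1k)).1.
have gapc (h : V) x1 : `|x1 - x0| < k.+1%:R^-1 ->
    `|z - h| - k.+1%:R * enorm (g z w - g h w) @[z --> x1] -->
    `|x1 - h| - k.+1%:R * enorm (g x1 w - g h w).
  move=> x1k; have ? := nbhs_filter x1.
  have h1 : `|z - h| @[z --> x1] --> `|x1 - h|.
    apply: cvg_norm; apply: (@cvgB _ V _ _ _ id (cst h)).
      exact: cvg_id.
    exact: cvg_cst.
  have h2 : enorm (g z w - g h w) @[z --> x1] --> enorm (g x1 w - g h w).
    exact: (cvg_comp _ _ (cvgB (gc x1 x1k) (cvg_cst (g h w))) (@enorm_continuous _ _ _)).
  have h3 : k.+1%:R * enorm (g z w - g h w) @[z --> x1] -->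
      k.+1%:R * enorm (g x1 w - g h w).
    by apply: cvgM; [exact: cvg_cst|exact: h2].
  exact: (cvgB h1 h3).
have [i [Oi gi]] : exists i, O k (q i) /\ 0 < gap k (q i) y w.
  apply: (qP x [set z | O k z /\ 0 < gap k z y w]); have near_gap := cvgr_gt _ (gapc y x xk) _ gap0.
  exact: (filterI (Oo x xk) (near_gap _)).
have gapC z1 z2 : gap k z1 z2 w = gap k z2 z1 w.
  rewrite /gap distrC; congr (_ - _ * _).
  by rewrite -[X in enorm X]opprB -scaleN1r enormZ normrN1 mul1r.
have [j [Oj gj]] : exists j, O k (q j) /\ 0 < gap k (q j) (q i) w.
  rewrite gapC in gi.
  apply: (qP y [set z | O k z /\ 0 < gap k z (q i) w]).
  have near_gap := cvgr_gt _ (gapc (q i) y yk) _ gi.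
  exact: (filterI (Oo y yk) (near_gap _)).
exists i => //; exists j => //; rewrite /Q asboolT//; split=> //=.
by rewrite gapC.
Qed.

End HighProbabilityLowerBound.

Section Sections.
Context d (Omega : measurableType d) (R : realType) (P : probability Omega R).
Context (p : nat) (Theta : set 'rV[R]_p) (F : set (set Omega)).
Hypothesis Theta_borel : measurable (Theta : set (borel_rV R p)).
Hypothesis F_sub : complete_sub_sigma_field P F.

Lemma estimating_function_section G t : estimating_function Theta F G -> Theta t ->
  coord_measurable (G t).
Proof.
move=> mG Tt; apply: measurable_coord => _ B mB; rewrite setTI.
pose T' := g_sigma_algebraType F.
have mT : measurable (Theta `*` [set: T'] : set (borel_rV R p * T')).
  exact: measurableX.
have := measurable_xsection (t : borel_rV R p) (mG mT B mB).
move=> /(sub_measurableE F_sub) FB; case: F_sub => _ FM _.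
rewrite (_ : G t @^-1` B = xsection ((Theta `*` setT) `&` (fun z => G z.1 z.2) @^-1` B) t).
  exact: FM.
apply/seteqP; split=> w; rewrite /xsection /= inE; first by move=> Bw; split.
by move=> [].
Qed.

Lemma estimator_event G that (theta : 'rV[R]_p) (a c : R) : 0 < a ->
  is_estimator Theta F G that ->
  measurable [set w | a * dist_delta (that w) theta <= c].
Proof.
move=> a0 [mthat _ _]; case: (F_sub) => _ FM _; apply: FM.
apply/(sub_measurableE F_sub).
pose W : set (option 'rV[R]_p) := [set x | a * dist_delta x theta <= c].
have mW : measurable (W : set (g_sigma_algebraType (@open_delta R p))).
  rewrite -(setCK W); apply: measurableC; apply: sub_sigma_algebra.
  rewrite /open_delta /= preimage_setC openC.
  by have := (continuous_closedP _).1 (@scaled_distance_continuous R p a theta) _ (@closed_le _ c).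
by have := mthat measurableT W mW; rewrite setTI.
Qed.

End Sections.

(** * Rates of convergence *)

Section RateFromTightness.
Context d (Omega : measurableType d) (R : realType) (P : probability Omega R).
Context (p : nat) (a : nat -> R) (that : nat -> Omega -> option 'rV[R]_p).
Variable theta : 'rV[R]_p.

Let E n c := [set w | a n * dist_delta (that n w) theta <= c].

Hypothesis mE : forall n c, measurable (E n c).

(** For each fixed n the distance is finite, so some constant works for that n alone. Finitely many
    such constants cover the indices below [N], and a sum of absolute values dominates all of them
    and the tail constant. *)
Lemma has_rate_of_tight :
  (forall e : R, 0 < e -> exists c N, forall n, (N <= n)%N -> exists B,
     [/\ measurable B, (P B < e%:E)%E & ~` B `<=` E n c]) ->
  has_rate P a that theta.
Proof.
move=> tight.
have E_mono n c1 c2 : c1 <= c2 -> E n c1 `<=` E n c2.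
  by move=> c12 w; rewrite /E /= => /le_trans; apply.
have unif (e : R) : 0 < e -> exists C, forall n, ((1 - e)%:E <= P (E n C))%E.
  move=> e0; have [c0 [N cN]] := tight e e0.
  have /choice[cc ccP] : forall n, exists c, ((1 - e)%:E <= P (E n c))%E.
    move=> n.
    pose B k := ~` E n k%:R.
    have mB k : measurable (B k) by exact: measurableC.
    have ninc : {homo B : n m / (n <= m)%N >-> (m <= n)%O}.
      move=> k m km; apply/subsetPset; apply: subsetC; apply: E_mono.
      by rewrite ler_nat.
    have B0 : P (\bigcap_k B k) = 0%E.
      rewrite (_ : \bigcap_k B k = set0) ?measure0// -subset0 => w Bw.
      apply: (Bw (Num.truncn (a n * dist_delta (that n w) theta)).+1 I).
      by rewrite /E /=; apply/ltW; exact: truncnS_gt.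
    have [k _ kP] := nonincreasing_near_lt e0 mB ninc B0.
    exists k%:R; rewrite -(setCK (E n k%:R)) probability_setC; last exact: mB.
    rewrite EFinB.
    by apply: leeB => //; apply: ltW; exact: (kP k (leqnn k)).
  exists (`|c0| + \sum_(i < N) `|cc i|) => n.
  have [nN|Nn] := ltnP n N.
    apply: le_trans (ccP n) _; apply: le_measure; rewrite ?inE //.
    apply: E_mono; apply: le_trans (ler_norm _) _.
    apply: le_trans (_ : _ <= \sum_(i < N) `|cc i|) _.
      by rewrite (bigD1 (Ordinal nN))//= lerDl sumr_ge0.
    by rewrite lerDr.
  have [B [mB PB BE]] := cN n Nn.
  apply: (@le_trans _ _ (P (~` B))).
    by rewrite probability_setC// EFinB; apply: leeB => //; exact: ltW.
  apply: le_measure; rewrite ?inE //; first exact: measurableC.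
  apply: subset_trans BE _; apply: E_mono; apply: le_trans (ler_norm _) _.
  by rewrite lerDl sumr_ge0.
pose f c := ereal_inf (range (fun n => P (E n c))).
have f1 c : (f c <= 1)%E.
  apply: (@le_trans _ _ (P (E 0%N c))); last exact: probability_le1.
  by apply: ereal_inf_lbound; exists 0%N.
have f0 c : (0 <= f c)%E by apply: le_ereal_inf_tmp => _ [n _ <-].
have ffin c : f c \is a fin_num.
  by rewrite ge0_fin_numE//; exact: le_lt_trans (f1 c) (ltry 1).
suff : f c @[c --> +oo%R] --> 1%E by [].
apply/fine_cvgP; split; first exact: nearW.
apply/cvgrPdist_le => e e0; have [C CP] := unif e e0.
exists C; split; first exact: num_real.
move=> c Cc /=; rewrite ger0_norm ?subr_ge0; last by rewrite -lee_fin fineK.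
rewrite lerBlDr addrC -lerBlDr -lee_fin fineK//.
apply: le_ereal_inf_tmp => _ [n _ <-]; apply: le_trans (CP n) _.
by apply: le_measure; rewrite ?inE //; apply: E_mono; exact: ltW.
Qed.

End RateFromTightness.

Section ZerosNearThetabar.
Context (d : measure_display) (Omega : measurableType d)
    (R : realType) (P : probability Omega R)
    (P_complete : measure_is_complete P)
    (p : nat) (Theta : set 'rV[R]_p)
    (Theta_borel : measurable (Theta : set (borel_rV R p)))
    (F : nat -> set (set Omega))
    (F_sub : forall n, complete_sub_sigma_field P (F n))
    (Gn : nat -> 'rV[R]_p -> Omega -> 'rV[R]_p)
    (Gn_est : forall n, estimating_function Theta (F n) (Gn n))
    (thetabar : 'rV[R]_p)
    (M : set 'rV[R]_p) (M_open : open M) (M_thetabar : M thetabar)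
    (M_sub : M `<=` Theta)
    (G : 'rV[R]_p -> Omega -> 'rV[R]_p)
    (G_meas : forall theta, M theta ->
       @measurable_fun _ _ Omega (borel_rV R p) setT (G theta))
    (C1 : {ae P, forall w,
       continuously_differentiable_on M (G ^~ w) /\
       forall n, continuously_differentiable_on M (Gn n ^~ w)})
    (jac_cvg : cvg_to_zero_in_probability P (fun n w =>
       ereal_sup [set (opnorm (jacobian (Gn n ^~ w) theta
                               - jacobian (G ^~ w) theta))%:E
                 | theta in M]))
    (jac_unit : {ae P, forall w, jacobian (G ^~ w) thetabar \in unitmx})
    (a : nat -> R) (a_gt0 : forall n, 0 < a n) (a_infty : a @ \oo --> +oo%R)
    (aGn_bounded : stochastically_bounded P
       (fun n w => enorm (a n *: Gn n thetabar w))).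

(** The existence clause serves the constructed estimator; the clause on all zeros in a ball of
    deterministic radius serves consistent estimators, which eventually lie in that ball with high
    probability. *)
Lemma zeros_near_thetabar (e : R) : 0 < e -> exists c r N, 0 < r /\
  forall n, (N <= n)%N -> exists B, [/\ measurable B, (P B < e%:E)%E &
    forall w, ~ B w ->
      (exists t, [/\ Theta t, Gn n t w = 0 & a n * enorm (t - thetabar) <= c]) /\
      forall t, `|t - thetabar| < r -> Gn n t w = 0 ->
        a n * enorm (t - thetabar) <= c].
Proof.
(* One third of [e] for each bad event: the lower bound for [G] fails, the Jacobians are far apart,
   or the scaled value at [thetabar] is large. *)
move=> e0; have e3 : 0 < e / 3 by rewrite divr_gt0.
have mG x : M x -> coord_measurable (G x).
  by move=> Mx; apply: measurable_coord; exact: G_meas.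
have mGn n x : M x -> coord_measurable (Gn n x).
  by move=> /M_sub Tx; exact: (estimating_function_section Theta_borel (F_sub n)).
have C1G : {ae P, forall w, continuously_differentiable_on M (G ^~ w)}.
  by move: C1; apply: filterS => w [].
have [r [K [B1 [r0 K0 rM [mB1 PB1 lb]]]]] :=
  lower_bound_event M_open M_thetabar mG C1G jac_unit e3.
have [K1 [K10 K1P]] := aGn_bounded e3.
(* Chosen so that an operator norm of at most [eta] gives the sup norm bound [(2 * K)^-1] of
   [lower_bound_perturbation]; [p.+1] is the cost of comparing norms. *)
pose eta := (2 * K * p.+1%:R)^-1.
have eta0 : 0 < eta by rewrite invr_gt0 !mulr_gt0.
pose B2 n := [set w | (eta%:E < ereal_sup
  [set (opnorm (jacobian (Gn n ^~ w) x - jacobian (G ^~ w) x))%:E | x in M])%E].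
have mB2 n : measurable (B2 n).
  apply: (measurable_jacobian_deviation P_complete M_open (mGn n) mG _ (ltW eta0)).
  by move: C1; apply: filterS => w [gC fC]; split; [exact: fC|exact: gC].
have [N1 _ N1P] : \forall n \near \oo, (P (B2 n) < (e / 3)%:E)%E.
  exact: (cvg0_near_lt e3 (jac_cvg eta0)).
pose B3 n := [set w | (K1 < enorm (a n *: Gn n thetabar w))%R].
have mB3 n : measurable (B3 n).
  rewrite -(setTI (B3 n)); apply: measurable_ltr_set => //; apply: measurable_enorm.
  by apply: coord_measurableZ; exact: mGn.
(* With lower bound constant [2 * K] and radius [r / 2], [zero_in_ball] needs 4 K |Gn n thetabar| <
   r / 2, and |Gn n thetabar| is at most K1 / a n. *)
have [N2 _ N2P] : \forall n \near \oo, 8 * K * K1 / r < a n.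
  by move/cvgryPgt : a_infty; exact.
have [N0 [mN0 PN0 N0P]] := C1.
exists (p.+1%:R * (2 * K * K1)), r, (maxn N1 N2); split=> // n Nn.
exists (B1 `|` B2 n `|` B3 n `|` N0); split.
- by do 3 apply: measurableU => //.
- have m12 := measurableU _ _ mB1 (mB2 n).
  have m123 := measurableU _ _ m12 (mB3 n).
  rewrite measureU0//.
  have -> : e%:E = ((e / 3)%:E + (e / 3)%:E + (e / 3)%:E)%E.
    by rewrite -!EFinD; congr (_%:E); field.
  apply: le_lt_trans (measureU2 P m12 (mB3 n)) _; apply: lteD; last exact: K1P.
  apply: le_lt_trans (measureU2 P mB1 (mB2 n)) _; apply: lteD => //.
  by apply: N1P; apply: leq_trans Nn; exact: leq_maxl.
move=> w nB.
have nB1 : ~ B1 w by move=> ?; apply: nB; do 3 left.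
have nB2 : ~ B2 n w by move=> ?; apply: nB; left; left; right.
have nB3 : ~ B3 n w by move=> ?; apply: nB; left; right.
have [gC fC] : continuously_differentiable_on M (G ^~ w) /\
    forall n, continuously_differentiable_on M (Gn n ^~ w).
  by apply: contrapT => nC; apply: nB; right; exact: N0P.
have lbn : forall x y, `|x - thetabar| < r -> `|y - thetabar| < r ->
    `|x - y| <= 2 * K * `|Gn n x w - Gn n y w|.
  apply: (lower_bound_perturbation K0 _ (lb w nB1)) => x xr.
  have Mx := rM x xr; split; [exact: (fC n x Mx).1|exact: (gC x Mx).1|] => u.
  apply: le_trans (norm_le_enorm _) _; apply: le_trans (opnorm_bound _ _) _.
  have op : opnorm (jacobian (Gn n ^~ w) x - jacobian (G ^~ w) x) <= eta.
    rewrite -lee_fin leNgt; apply/negP => lt; apply: nB2; rewrite /B2 /=.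
    by apply: (lt_le_trans lt); apply: ereal_sup_ubound; exists x.
  apply: le_trans (ler_wpM2r (enorm_ge0 _) op) _.
  apply: le_trans (ler_wpM2l (ltW eta0) (enorm_le_norm u)) _.
  by rewrite mulrA /eta invfM mulfVK// pnatr_eq0.
have aG : a n * enorm (Gn n thetabar w) <= K1.
  rewrite -[a n]gtr0_norm// -enormZ leNgt; apply/negP; exact: nB3.
have zero_bound t : `|t - thetabar| < r -> Gn n t w = 0 ->
    a n * enorm (t - thetabar) <= p.+1%:R * (2 * K * K1).
  move=> tr Gt.
  have := lbn t thetabar tr; rewrite subrr normr0 Gt sub0r normrN => /(_ r0) h.
  apply: le_trans (ler_wpM2l (ltW (a_gt0 n)) (enorm_le_norm _)) _.
  rewrite mulrCA ler_wpM2l//.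
  apply: le_trans (ler_wpM2l (ltW (a_gt0 n)) h) _; rewrite mulrCA ler_pM2l ?mulr_gt0//.
  apply: le_trans aG; rewrite ler_pM2l//; exact: norm_le_enorm.
split=> //.
have s0 : 0 < r / 2 by rewrite divr_gt0.
have sr : r / 2 < r by rewrite ltr_pdivrMr// ltr_pMr// ltr1n.
have K20 : 0 <= 2 * K by rewrite mulr_ge0// ltW.
have small : 2 * (2 * K) * `|Gn n thetabar w| < r / 2.
  have an : 8 * K * K1 / r < a n.
    by apply: N2P; apply: leq_trans Nn; exact: leq_maxr.
  have h1 : a n * `|Gn n thetabar w| <= K1.
    by apply: le_trans aG; rewrite ler_pM2l//; exact: norm_le_enorm.
  rewrite -(ltr_pM2l (a_gt0 n)).
  have -> : a n * (2 * (2 * K) * `|Gn n thetabar w|) =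
      (4 * K) * (a n * `|Gn n thetabar w|) by ring.
  apply: (@le_lt_trans _ _ (4 * K * K1)); first by rewrite ler_pM2l// mulr_gt0.
  move: an; rewrite ltr_pdivrMr// => an.
  by rewrite mulrA ltr_pdivlMr//; move: an; congr (_ < _); ring.
have [t tr Gt] := zero_in_ball s0 sr K20 (fun x xr => (fC n x (rM x xr)).1) lbn small.
by exists t; split=> //; [apply/M_sub/rM|exact: zero_bound].
Qed.

End ZerosNearThetabar.

Theorem theorem2p9 (d : measure_display) (Omega : measurableType d)
    (R : realType) (P : probability Omega R)
    (P_complete : measure_is_complete P)
    (p : nat) (Theta : set 'rV[R]_p)
    (Theta_borel : measurable (Theta : set (borel_rV R p)))
    (F : nat -> set (set Omega))
    (F_sub : forall n, complete_sub_sigma_field P (F n))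
    (Gn : nat -> 'rV[R]_p -> Omega -> 'rV[R]_p)
    (Gn_est : forall n, estimating_function Theta (F n) (Gn n))
    (thetabar : 'rV[R]_p) (thetabar_int : interior Theta thetabar)
    (M : set 'rV[R]_p) (M_open : open M) (M_thetabar : M thetabar)
    (M_sub : M `<=` Theta)
    (G : 'rV[R]_p -> Omega -> 'rV[R]_p)
    (G_meas : forall theta, M theta ->
       @measurable_fun _ _ Omega (borel_rV R p) setT (G theta))
    (Gn_thetabar :
       cvg_to_zero_in_probability P (fun n w => (enorm (Gn n thetabar w))%:E))
    (G_thetabar : {ae P, forall w, G thetabar w = 0})
    (C1 : {ae P, forall w,
       continuously_differentiable_on M (G ^~ w) /\
       forall n, continuously_differentiable_on M (Gn n ^~ w)})
    (jac_cvg : cvg_to_zero_in_probability P (fun n w =>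
       ereal_sup [set (opnorm (jacobian (Gn n ^~ w) theta
                               - jacobian (G ^~ w) theta))%:E
                 | theta in M]))
    (jac_unit : {ae P, forall w, jacobian (G ^~ w) thetabar \in unitmx})
    (a : nat -> R) (a_gt0 : forall n, 0 < a n)
    (a_incr : nondecreasing_seq a) (a_infty : a @ \oo --> +oo%R)
    (aGn_bounded : stochastically_bounded P
       (fun n w => enorm (a n *: Gn n thetabar w))) :
  (exists that : nat -> Omega -> option 'rV[R]_p,
     (forall n, is_estimator Theta (F n) (Gn n) (that n)) /\
     has_rate P a that thetabar) /\
  (forall that : nat -> Omega -> option 'rV[R]_p,
     (forall n, is_estimator Theta (F n) (Gn n) (that n)) ->
     weakly_consistent P that thetabar ->
     has_rate P a that thetabar).
Proof.
have mE that : (forall n, is_estimator Theta (F n) (Gn n) (that n)) ->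
    forall n c, measurable [set w | a n * dist_delta (that n w) thetabar <= c].
  by move=> est n c; apply: estimator_event; [exact: F_sub n|exact: a_gt0|exact: est].
have zeros e := @zeros_near_thetabar _ _ _ _ P_complete _ _ Theta_borel _ F_sub _
  Gn_est _ _ M_open M_thetabar M_sub _ G_meas C1 jac_cvg jac_unit _ a_gt0 a_infty
  aGn_bounded e.
split.
  have /choice[that thatP] := fun n =>
    near_optimal_estimator Theta_borel (F_sub n) thetabar (a_gt0 n) (Gn_est n).
  have est n : is_estimator Theta (F n) (Gn n) (that n) by case: (thatP n).
  exists that; split=> //; apply: has_rate_of_tight; first exact: mE.
  move=> e /zeros[c [r [N [_ zN]]]]; exists (c + 1), N => n /zN[B [mB PB BP]].
  exists B; split=> // w /BP[[t [Tt Gt tc]] _] /=.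
  by apply: le_trans ((thatP n).2 w t Tt Gt) _; rewrite lerD2r.
move=> that est wc; apply: has_rate_of_tight; first exact: mE.
move=> e e0; have e2 : 0 < e / 2 by rewrite divr_gt0.
have [c [r [N [r0 zN]]]] := zeros _ e2.
(* Below [r], so that a close estimator lies in the ball where zeros are controlled, and below 1, so
   that the value [None], at distance 1, is excluded. *)
pose s := Num.min r 1 / 2.
have m0 : 0 < Num.min r 1 by rewrite lt_min r0 ltr01.
have s0 : 0 < s by rewrite divr_gt0.
have : s < Num.min r 1 by rewrite ltr_pdivrMr// ltr_pMr// ltr1n.
rewrite lt_min => /andP[sr s1].
have [N1 _ N1P] := cvg0_near_lt e2 (wc s s0).
exists c, (maxn N N1) => n; rewrite geq_max => /andP[/zN[B [mB PB BP]] /N1P Pfar].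
have mfar : measurable [set w | (s%:E < (dist_delta (that n w) thetabar)%:E)%E].
  rewrite (_ : mkset _ = ~` [set w | 1 * dist_delta (that n w) thetabar <= s]).
    by apply: measurableC; apply: estimator_event; [exact: F_sub n|exact: ltr01|exact: est].
  by apply/seteqP; split=> w /=; rewrite lte_fin mul1r ltNge => /negP.
exists (B `|` [set w | (s%:E < (dist_delta (that n w) thetabar)%:E)%E]); split.
- exact: measurableU.
- apply: le_lt_trans (measureU2 P mB mfar) _.
  by rewrite [e]splitr EFinD; exact: lteD.
move=> w /not_orP[/BP[_ near_zero] /negP]; rewrite lte_fin -leNgt /=.
case: (est n) => _ solv unsolv.
have [/solv[t [-> _ Gt]]|/unsolv ->] := pselect (solvable_event Theta (Gn n) w).
  move=> /= ts; apply: near_zero => //; apply: le_lt_trans sr.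
  exact: le_trans (norm_le_enorm _) ts.
by rewrite /= leNgt s1.
Qed.
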